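(* Let $\mathcal L$ be a semilattice and $(\mathfrak A,(A_\ell)_{\ell\in\mathcal L})$ an $\mathcal L$-graded $C^*$-algebra. Suppose that the structure morphisms $\varphi_{k,\ell}:A_\ell\to M(A_k)$ satisfy $\varphi_{k,\ell}^{-1}(A_k)=\{0\}$ for all $k,\ell\in\mathcal L$ with $k<\ell$. Then for every $i\in\mathcal L$ the map $\varphi_i:\overline{\mathfrak A_{\mathcal L_i}}\to M(A_i)$ is injective.
   Context: A semilattice is a partially ordered set $\mathcal L$ in which any two elements $k,\ell$ have a greatest lower bound $k\wedge\ell$. A $C^*$-algebra $\mathfrak A$ is $\mathcal L$-graded with components $(A_i)_{i\in\mathcal L}$, written $(\mathfrak A,(A_i)_{i\in\mathcal L})$, if $(A_i)_{i\in\mathcal L}$ is a family of sub-$C^*$-algebras of $\mathfrak A$ which is linearly independent (if $S_i\in A_i$, only finitely many $S_i$ are nonzero and $\sum_i S_i=0$, then all $S_i=0$), total (the linear span of $\bigcup_i A_i$ is dense in $\mathfrak A$), and satisfies $A_iA_j\subset A_{i\wedge j}$ for all $i,j\in\mathcal L$. $M(A)$ denotes the multiplier algebra of $A$, containing $A$. For $i\in\mathcal L$ put $\mathcal L_i=\{j\in\mathcal L: i\le j\}$, and let $\overline{\mathfrak A_{\mathcal L_i}}$ be the closure in $\mathfrak A$ of $\bigoplus_{j\in\mathcal L_i}A_j$; it is a sub-$C^*$-algebra in which $A_i$ is a closed ideal, and $\varphi_i:\overline{\mathfrak A_{\mathcal L_i}}\to M(A_i)$ is the resulting morphism, $\varphi_i(a)x=ax$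 for $x\in A_i$. For $k\le\ell$ the structure morphism $\varphi_{k,\ell}:A_\ell\to M(A_k)$ is the restriction of $\varphi_k$ to $A_\ell$, i.e. $\varphi_{k,\ell}(y)x=yx$ for $x\in A_k$, $y\in A_\ell$. *)

(* Defs.v *)
From HB Require Import structures.
From mathcomp Require Import all_boot all_order all_algebra.
From mathcomp Require Import complex.
From mathcomp Require Import all_classical all_reals all_analysis.

Set Implicit Arguments.
Unset Strict Implicit.
Unset Printing Implicit Defensive.

Import Order.TTheory GRing.Theory Num.Theory.

Local Open Scope classical_set_scope.
Local Open Scope ring_scope.

(* C*-algebras need not be unital, so the product cannot be the one of a
   MathComp ring.  Norms take their values in R[i], on the nonnegative reals. *)
HB.mixin Record CompleteNormedModule_isCstarAlgebra (R : realType) A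
    & CompleteNormedModule R[i] A := {
  cmul : A -> A -> A ;
  cstar : A -> A ;
  cmulA : associative cmul ;
  cmulDl : left_distributive cmul +%R ;
  cmulDr : right_distributive cmul +%R ;
  cmulZl : forall (k : R[i]) a b, cmul (k *: a) b = k *: cmul a b ;
  cmulZr : forall (k : R[i]) a b, cmul a (k *: b) = k *: cmul a b ;
  cstarK : involutive cstar ;
  cstarD : {morph cstar : a b / a + b} ;
  cstarZ : forall (k : R[i]) a, cstar (k *: a) = Num.conj k *: cstar a ;
  cstarM : forall a b, cstar (cmul a b) = cmul (cstar b) (cstar a) ;
  ler_norm_cmul : forall a b, `|cmul a b| <= `|a| * `|b| :> R[i] ;
  norm_cstar_cmul : forall a, `|cmul (cstar a) a| = `|a| ^+ 2 :> R[i]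
}.

#[short(type="cstarAlgType")]
HB.structure Definition CstarAlgebra (R : realType) :=
  {A of CompleteNormedModule R[i] A & CompleteNormedModule_isCstarAlgebra R A}.

Declare Scope cstar_scope.
Delimit Scope cstar_scope with cstar.
Notation "a ** b" := (cmul a b) (at level 40, left associativity) : cstar_scope.
Notation "a ^#" := (cstar a) (at level 2, format "a ^#") : cstar_scope.
Local Open Scope cstar_scope.

Section product.
Variables (R : realType) (A : cstarAlgType R).
Implicit Types a b c : A.

Lemma cmulBl a b c : (a - b) ** c = a ** c - b ** c.
Proof. by rewrite cmulDl -scaleN1r cmulZl scaleN1r. Qed.

Lemma cmulBr a b c : a ** (b - c) = a ** b - a ** c.
Proof. by rewrite cmulDr -scaleN1r cmulZr scaleN1r. Qed.

Lemma cmul_continuousl a : continuous (fun x : A => a ** x).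
Proof.
move=> x; apply/cvgrPdist_lt => e e0; near=> y; rewrite -cmulBr.
apply: le_lt_trans (ler_norm_cmul _ _) _.
apply: (@le_lt_trans _ _ (`|x - y| * (`|a| + 1))).
  by rewrite mulrC ler_wpM2l// lerDl.
rewrite -ltr_pdivlMr ?ltr_wpDl//.
by near: y; apply: cvgr_dist_lt; rewrite ?divr_gt0 ?ltr_wpDl.
Unshelve. all: by end_near. Qed.

Lemma cmul_continuousr a : continuous (fun x : A => x ** a).
Proof.
move=> x; apply/cvgrPdist_lt => e e0; near=> y; rewrite -cmulBl.
apply: le_lt_trans (ler_norm_cmul _ _) _.
apply: (@le_lt_trans _ _ (`|x - y| * (`|a| + 1))).
  by rewrite ler_wpM2l// lerDl.
rewrite -ltr_pdivlMr ?ltr_wpDl//.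
by near: y; apply: cvgr_dist_lt; rewrite ?divr_gt0 ?ltr_wpDl.
Unshelve. all: by end_near. Qed.

End product.

Record subCstarAlg (R : realType) (A : cstarAlgType R) := SubCstarAlg {
  carrier : set A ;
  carrier0 : carrier 0 ;
  carrierD : forall a b, carrier a -> carrier b -> carrier (a + b) ;
  carrierZ : forall (k : R[i]) a, carrier a -> carrier (k *: a) ;
  carrierM : forall a b, carrier a -> carrier b -> carrier (a ** b) ;
  carrier_star : forall a, carrier a -> carrier (a^#) ;
  carrier_closed : closed carrier
}.

Definition sub_type (R : realType) (A : cstarAlgType R) (B : subCstarAlg A) :=
  {x : A | x \in carrier B}.
Coercion sub_type : subCstarAlg >-> Sortclass.

Section sub_type.
Variables (R : realType) (A : cstarAlgType R) (B : subCstarAlg A).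

HB.instance Definition _ := [isSub for @sval A (fun x => x \in carrier B) : B -> A].
HB.instance Definition _ := [Choice of B by <:].

Lemma carrierP (x : B) : carrier B (val x).
Proof. exact: set_mem (valP x). Qed.

Definition insubC (a : A) (Ba : carrier B a) : B := exist _ a (mem_set Ba).

Let sub_submod : submod_closed (fun x : A => x \in carrier B).
Proof.
split=> [|k a b /set_mem Ba /set_mem Bb]; apply: mem_set; first exact: carrier0.
by apply: carrierD => //; exact: carrierZ.
Qed.

HB.instance Definition _ := GRing.SubChoice_isSubLmodule.Build R[i] A
  (fun x => x \in carrier B) B sub_submod.

Let sub_norm (x : B) : R[i] := `|val x|.

Let sub_normD (x y : B) : sub_norm (x + y) <= sub_norm x + sub_norm y.
Proof. exact: ler_normD. Qed.

Let sub_normZ (k : R[i]) (x : B) : sub_norm (k *: x) = `|k| * sub_norm x.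
Proof. exact: normrZ. Qed.

Let sub_norm_eq0 (x : B) : sub_norm x = 0 -> x = 0.
Proof. by move=> /normr0_eq0 x0; apply: val_inj. Qed.

HB.instance Definition _ :=
  Lmodule_isNormed.Build R[i] B sub_normD sub_normZ sub_norm_eq0.

Lemma sub_normE (x : B) : `|x| = `|val x| :> R[i].
Proof. by []. Qed.

Let sub_complete (F : set_system B) : ProperFilter F -> cauchy F -> cvg F.
Proof.
move=> FF cF; pose G : set_system A := val @ F.
have cG : cauchy G.
  apply/cauchy_ballP => e e0; have /cauchy_ballP/(_ e e0) := cF.
  move=> [[P Q] /= [FP FQ] PQ].
  exists (val @` P, val @` Q) => /=.
    by split; [apply: filterS FP|apply: filterS FQ] => x Px; exists x.
  move=> [_ _] /= [[x Px <-] [y Qy <-]].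
  by have := PQ (x, y) (conj Px Qy); rewrite -!ball_normE.
have Ga : G --> lim G by exact: cauchy_cvg.
set a := lim G in Ga.
have Ba : carrier B a.
  apply: (@closed_cvg B A F FF val (carrier B) (@carrier_closed _ _ B) _ a Ga).
  by apply: nearW => x; exact: carrierP.
apply/cvg_ex; exists (insubC Ba); apply/cvgrPdist_lt => e e0.
by move/cvgrPdist_lt : Ga => /(_ e e0).
Qed.

HB.instance Definition _ := Uniform_isComplete.Build B sub_complete.

Let sub_mul (x y : B) : B := insubC (carrierM (carrierP x) (carrierP y)).
Let sub_star (x : B) : B := insubC (carrier_star (carrierP x)).

Definition sub_cstar : CompleteNormedModule_isCstarAlgebra R B.
Proof.
refine (@CompleteNormedModule_isCstarAlgebra.Build R B sub_mul sub_star
  _ _ _ _ _ _ _ _ _ _ _).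
- by move=> x y z; apply: val_inj; exact: cmulA.
- by move=> x y z; apply: val_inj; exact: cmulDl.
- by move=> x y z; apply: val_inj; exact: cmulDr.
- by move=> k x y; apply: val_inj; exact: cmulZl.
- by move=> k x y; apply: val_inj; exact: cmulZr.
- by move=> x; apply: val_inj; exact: cstarK.
- by move=> x y; apply: val_inj; exact: cstarD.
- by move=> k x; apply: val_inj; exact: cstarZ.
- by move=> x y; apply: val_inj; exact: cstarM.
- by move=> x y; exact: ler_norm_cmul.
- by move=> x; exact: norm_cstar_cmul.
Defined.

HB.instance Definition _ := sub_cstar.

Lemma val_cmul (x y : B) : val (x ** y) = val x ** val y.
Proof. by []. Qed.

Lemma val_cstar (x : B) : val (x^#) = (val x)^#.
Proof. by []. Qed.

Lemma val_continuous : continuous (val : B -> A).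
Proof.
move=> x; apply/(@cvgrPdist_lt _ _ _ (nbhs x)) => e e0.
near=> y; rewrite -[ltLHS]/(`|x - y|); near: y; exact: cvgr_dist_lt.
Unshelve. all: by end_near. Qed.

End sub_type.

(* The multiplier algebra M(A), realised as the double centralizers
   (L, R) = (lmult, rmult) of A; mult_embed is the inclusion of A in M(A). *)
Record multiplier (R : realType) (A : cstarAlgType R) := Multiplier {
  lmult : A -> A ;
  rmult : A -> A ;
  lmult_linear : linear lmult ;
  rmult_linear : linear rmult ;
  lmult_continuous : continuous lmult ;
  rmult_continuous : continuous rmult ;
  multiplierP : forall a b, a ** lmult b = rmult a ** b
}.

Lemma multiplier_eq (R : realType) (A : cstarAlgType R) (m n : multiplier A) :
  lmult m =1 lmult n -> rmult m =1 rmult n -> m = n.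
Proof.
case: m n => [L1 R1 a1 b1 c1 d1 e1] [L2 R2 a2 b2 c2 d2 e2] /=.
move=> /funext eL /funext eR; subst L2 R2.
by congr Multiplier; exact: Prop_irrelevance.
Qed.

Section mult_of.
Variables (R : realType) (A : cstarAlgType R) (B : subCstarAlg A) (a : A).
Hypothesis aBl : forall x, carrier B x -> carrier B (a ** x).
Hypothesis aBr : forall x, carrier B x -> carrier B (x ** a).

Let L (x : B) : B := insubC (aBl (carrierP x)).
Let T (x : B) : B := insubC (aBr (carrierP x)).

Let L_linear : linear L.
Proof. by move=> k x y; apply: val_inj; rewrite /= cmulDr cmulZr. Qed.

Let T_linear : linear T.
Proof. by move=> k x y; apply: val_inj; rewrite /= cmulDl cmulZl. Qed.

Let L_continuous : continuous L.
Proof.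
move=> x; apply/(@cvgrPdist_lt _ _ _ (nbhs x)) => e e0.
have /(@cvgrPdist_lt _ _ _ (nbhs x))/(_ e e0) := cvg_comp _ _ (@val_continuous _ _ B x)
  (@cmul_continuousl _ _ a (val x)).
exact.
Qed.

Let T_continuous : continuous T.
Proof.
move=> x; apply/(@cvgrPdist_lt _ _ _ (nbhs x)) => e e0.
have /(@cvgrPdist_lt _ _ _ (nbhs x))/(_ e e0) := cvg_comp _ _ (@val_continuous _ _ B x)
  (@cmul_continuousr _ _ a (val x)).
exact.
Qed.

Let LTP x y : x ** L y = T x ** y.
Proof. by apply: val_inj; rewrite !val_cmul /= cmulA. Qed.

Definition mult_of : multiplier B :=
  Multiplier L_linear T_linear L_continuous T_continuous LTP.

End mult_of.

Definition mult_embed (R : realType) (A : cstarAlgType R) (a : A) : multiplier A.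
Proof.
refine (@Multiplier R A (fun x => a ** x) (fun x => x ** a) _ _ _ _ _).
- by move=> k x y; rewrite cmulDr cmulZr.
- by move=> k x y; rewrite cmulDl cmulZl.
- exact: cmul_continuousl.
- exact: cmul_continuousr.
- by move=> x y; rewrite cmulA.
Defined.

Definition linear_span (K : pzRingType) (V : lmodType K) (X : set V) : set V :=
  smallest (fun M : set V =>
    M 0 /\ forall (k : K) u v, M u -> M v -> M (k *: u + v)) X.

Record graded (d : Order.disp_t) (L : meetSemilatticeType d) (R : realType)
    (A : cstarAlgType R) (A_ : L -> subCstarAlg A) : Prop := Graded {
  graded_free : forall S : L -> A, (forall i, carrier (A_ i) (S i)) ->
    finite_set [set i | S i != 0] -> \sum_(i \in [set: L]) S i = 0 ->
    forall i, S i = 0 ;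
  graded_total : dense (linear_span (\bigcup_i carrier (A_ i))) ;
  graded_mul : forall i j a b, carrier (A_ i) a -> carrier (A_ j) b ->
    carrier (A_ (i `&` j)%O) (a ** b)
}.

Section structure_morphisms.
Variables (d : Order.disp_t) (L : meetSemilatticeType d) (R : realType).
Variables (A : cstarAlgType R) (A_ : L -> subCstarAlg A).

Definition up (i : L) : set L := [set j | (i <= j)%O].

Definition component_sum (J : set L) : set A :=
  [set a | exists S : L -> A, [/\ forall j, carrier (A_ j) (S j),
     finite_set [set j | S j != 0] & a = \sum_(j \in J) S j]].

Definition up_alg (i : L) : set A := closure (component_sum (up i)).

Hypothesis grA : graded A_.

Let component_sum_ideal i a x : component_sum (up i) a -> carrier (A_ i) x ->
  carrier (A_ i) (a ** x) /\ carrier (A_ i) (x ** a).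
Proof.
move=> [S [AS _ ->]] Ax; rewrite big_seq.
elim/big_ind: _ => [|b c [bl br] [cl cr]|j].
- by rewrite -(scale0r 0) cmulZl cmulZr !scale0r; split; exact: carrier0.
- by rewrite cmulDl cmulDr; split; exact: carrierD.
- case: finite_supportP => // X Xup _ _ /Xup ij.
  have [meet1 meet2] : (j `&` i = i /\ i `&` j = i)%O.
    by rewrite meet_r// meet_l.
  by split; [rewrite -[X in A_ X]meet1|rewrite -[X in A_ X]meet2];
    exact: graded_mul.
Qed.

Lemma up_alg_ideal i a x : up_alg i a -> carrier (A_ i) x ->
  carrier (A_ i) (a ** x) /\ carrier (A_ i) (x ** a).
Proof.
move=> ia Ax.
have cl (f : A -> A) : continuous f ->
    (forall b, component_sum (up i) b -> carrier (A_ i) (f b)) ->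
    carrier (A_ i) (f a).
  move=> cf fS; suff : closure (f @^-1` carrier (A_ i)) a.
    rewrite -(closure_id _).1//; apply: preimage_closed (@carrier_closed _ _ _).
    by move=> b _; exact: cf.
  exact: closureS ia.
split.
- by apply: (cl (fun b => b ** x)) => [|b /component_sum_ideal/(_ Ax)[]//];
    exact: cmul_continuousr.
- by apply: (cl (fun b => x ** b)) => [|b /component_sum_ideal/(_ Ax)[]//];
    exact: cmul_continuousl.
Qed.

Lemma component_up_alg i j x : (i <= j)%O -> carrier (A_ j) x -> up_alg i x.
Proof.
move=> ij Ax; apply: subset_closure; exists (fun l => if l == j then x else 0).
split=> [l||].
- by case: eqP => [->//|_]; exact: carrier0.
- apply: (sub_finite_set _ (finite_set1 j)) => l /=.
  by case: (l =P j) => // _; rewrite eqxx.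
- rewrite -(@fsbig_widen _ _ _ _ [set j]).
  + by rewrite fsbig_set1 eqxx.
  + by move=> _ ->.
  + by move=> l [_ /eqP/negbTE lj] /=; rewrite lj.
Qed.

(* phi grA a is the multiplier x |-> ax of A_i. *)
Definition phi (i : L) (a : up_alg i) : multiplier (A_ i) :=
  mult_of (fun x Ax => (up_alg_ideal (set_mem (valP a)) Ax).1)
          (fun x Ax => (up_alg_ideal (set_mem (valP a)) Ax).2).

Definition structure_morphism (k l : L) (kl : (k <= l)%O) (y : A_ l) :
    multiplier (A_ k) :=
  phi (exist _ (val y) (mem_set (component_up_alg kl (carrierP y))) : up_alg k).

End structure_morphisms.

(* Main.v *)
Require Import Defs.
From mathcomp Require Import all_boot all_order all_algebra.
From mathcomp Require Import complex ring lra.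
From mathcomp Require Import all_classical all_reals all_analysis.

Set Implicit Arguments.
Unset Strict Implicit.
Unset Printing Implicit Defensive.

Import Order.TTheory GRing.Theory Num.Theory.

Local Open Scope classical_set_scope.
Local Open Scope ring_scope.
Local Open Scope cstar_scope.

(** Let a be the difference of two elements with the same image under the
    morphism to M(A_i): it annihilates A_i on both sides and is a limit of finite
    sums b of elements of components A_j with i <= j. The argument has an
    algebraic and an analytic half.

    Algebraically (sum_over_annihilates), a finite sum which annihilates A_i is
    0. Its indices may be put in a finite subsemilattice F with minimum i. By
    induction on F, multiplication by a component pushes the sum to a smaller
    subsemilattice, where it vanishes; comparing components, the coefficient at
    a maximal index m either is annihilated by A_m, or acts on some A_n with
    n < m as an element of A_n, which the hypothesis on the structure morphisms
    excludes unless that coefficient is 0.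

    Injectivity on a dense subalgebra says nothing about its completion, so the
    analytic half (nrm_le_dist) is needed: if C and I are sub-C*-algebras with
    C I and I C contained in I and C disjoint from I, then |c| <= |c + y| for c
    in C and y in I. It shows first that the finite sums over a finite
    subsemilattice form a closed subalgebra (sum_over_closed), by adjoining one
    maximal index at a time; and then, with I the annihilator of A_i, that a
    finite sum b is no larger than its distance to the annihilator, so that a
    is 0 as a limit of such sums (approximable_annihilates).

    For nrm_le_dist, a failure can be amplified by taking powers into a
    self-adjoint k of norm 1 in C whose class modulo I has norm at most 1/10.
    The element f = max (k^2 - 9/10, 0) of C is not 0, has small norm and
    satisfies 9/10 f = k^2 f - f^2; modulo I, the right-hand side has norm at
    most that of f times a constant smaller than 9/10, so f lies in I and is 0,
    a contradiction. The truncation f is built by hand as a limit of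
    polynomials in k, from the power series iteration for the square root. Its
    properties rest on one inequality, |p|^2 <= |p^2 + q^2| for real polynomials
    p and q in k acting on A by multiplication (opnorm_sqr), which replaces
    spectral theory. *)

(** * Square roots and truncations under a real function seminorm *)

(** The last hypothesis is the inequality which singles out the algebras of
    real continuous functions among the commutative real Banach algebras: in
    such an algebra, sums of squares behave as positive elements. *)
Section real_function_seminorm.
Variables (R : realType) (E : comAlgType R) (nu : E -> R).
Local Notation cst := (in_alg E).
Hypothesis nu_ge0 : forall p, 0 <= nu p.
Hypothesis nuD : forall p q, nu (p + q) <= nu p + nu q.
Hypothesis nuM : forall p q, nu (p * q) <= nu p * nu q.
Hypothesis nu_cst : forall a : R, nu (cst a) <= `|a|.
Hypothesis nu_sqr : forall p q, nu p ^+ 2 <= nu (p ^+ 2 + q ^+ 2).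

Let half : E := cst (2^-1).
Let halfE : half + half = 1.
Proof. by rewrite /half -rmorphD (_ : _ + _ = 1) ?rmorph1 //; lra. Qed.

Lemma nuZ a p : nu (cst a * p) <= `|a| * nu p.
Proof. exact: le_trans (nuM _ _) (ler_wpM2r (nu_ge0 _) (nu_cst _)). Qed.

Lemma nuN p : nu (- p) <= nu p.
Proof.
by have := nuZ (-1) p; rewrite rmorphN rmorph1 mulN1r normrN1 mul1r.
Qed.

Lemma nuB p q : nu (p - q) <= nu p + nu q.
Proof. exact: le_trans (nuD _ _) (lerD (lexx _) (nuN _)). Qed.

Lemma nu1 : nu 1 <= 1.
Proof. by have := nu_cst 1; rewrite rmorph1 normr1. Qed.

Lemma nu_sqr_le p : nu p ^+ 2 <= nu (p ^+ 2).
Proof. by have := nu_sqr p 0; rewrite expr0n addr0. Qed.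

(** The fixed point equation s = (x + s^2) / 2 is (1 - s)^2 = 1 - x, so that
    1 - sqrt_iter x n approaches a square root of 1 - x. *)
Fixpoint sqrt_iter (x : E) n : E :=
  if n is n'.+1 then half * (x + sqrt_iter x n' ^+ 2) else 0.

(** The iteration at x = 1, which dominates all the others because
    sqrt_iter x n is a polynomial in x with nonnegative coefficients. *)
Fixpoint sqrt_iter1 n : R :=
  if n is n'.+1 then 2^-1 * (1 + sqrt_iter1 n' ^+ 2) else 0.

(** With u = 1 - sqrt_iter1 n one has u' = u - u^2 / 2, and the bound
    2 / (n + 2) is stable because u - u^2 / 2 increases on [0, 1]. *)
Lemma sqrt_iter1_bounds n :
  [/\ 0 <= sqrt_iter1 n, sqrt_iter1 n <= 1 & 1 - sqrt_iter1 n <= 2 / n.+2%:R].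
Proof.
elim: n => [|n [s0 s1 sn]] /=; first by rewrite subr0 divrr ?unitfE.
split; [nra|nra|].
set s := sqrt_iter1 n in s0 s1 sn *; set t : R := n.+2%:R in sn.
have t2 : 2 <= t by rewrite /t ler_nat.
have -> : n.+3%:R = t + 1 :> R by rewrite /t -natr1.
rewrite ler_pdivlMr; last lra.
rewrite ler_pdivlMr in sn; last lra.
suff : (1 - s) * (1 + s) * (t + 1) <= 4 by lra.
have -> : (1 - s) * (1 + s) * (t + 1)
    = 2 * ((1 - s) * t) + 2 * (1 - s) - (1 - s) * ((1 - s) * t) - (1 - s) ^+ 2.
  by ring.
nra.
Qed.

Lemma nu0 : nu 0 <= 0.
Proof. by have := nu_cst 0; rewrite rmorph0 normr0. Qed.

(** Both bounds follow from the nonnegativity of the coefficients, here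
    through s'' - s' = (s' - s) (s' + s) / 2. *)
Lemma sqrt_iter_bounds x n : nu x <= 1 ->
  nu (sqrt_iter x n) <= sqrt_iter1 n /\
  nu (sqrt_iter x n.+1 - sqrt_iter x n) <= sqrt_iter1 n.+1 - sqrt_iter1 n.
Proof.
have half_le p : nu (half * p) <= 2^-1 * nu p.
  by apply: le_trans (nuZ _ _) _; rewrite ger0_norm// invr_ge0.
move=> x1; elim: n => [|n [sn dn]].
  split; first exact: nu0.
  rewrite /= expr0n addr0 subr0 expr0n addr0 subr0.
  by apply: (le_trans (half_le x)); rewrite ler_pM2l// invr_gt0.
have sn' : nu (sqrt_iter x n.+1) <= sqrt_iter1 n.+1.
  rewrite [sqrt_iter _ _]/= [sqrt_iter1 _]/=; apply: (le_trans (half_le _)).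
  rewrite ler_pM2l ?invr_gt0//; apply: (le_trans (nuD _ _)).
  rewrite lerD// expr2 expr2; apply: (le_trans (nuM _ _)).
  by apply: ler_pM.
split=> //.
set s := sqrt_iter x n in dn sn; set t := sqrt_iter x n.+1 in dn sn' *.
set a := sqrt_iter1 n in dn sn; set b := sqrt_iter1 n.+1 in dn sn' *.
have -> : sqrt_iter x n.+2 - t = half * ((t - s) * (t + s)).
  have -> : sqrt_iter x n.+2 = half * (x + t ^+ 2) by [].
  by rewrite {2}(_ : t = half * (x + s ^+ 2))//; ring.
have -> : sqrt_iter1 n.+2 - b = 2^-1 * ((b - a) * (b + a)).
  have -> : sqrt_iter1 n.+2 = 2^-1 * (1 + b ^+ 2) by [].
  by rewrite {2}(_ : b = 2^-1 * (1 + a ^+ 2))//; ring.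
apply: (le_trans (half_le _)); rewrite ler_pM2l ?invr_gt0//.
apply: (le_trans (nuM _ _)); apply: ler_pM => //.
by apply: (le_trans (nuD _ _)); exact: lerD.
Qed.

Lemma sqrt_iter_cauchy x n m : nu x <= 1 -> (n <= m)%N ->
  nu (sqrt_iter x m - sqrt_iter x n) <= 2 / n.+2%:R.
Proof.
move=> x1 nm; have [_ sm1 _] := sqrt_iter1_bounds m.
have [_ _ sn1] := sqrt_iter1_bounds n.
suff : nu (sqrt_iter x m - sqrt_iter x n) <= sqrt_iter1 m - sqrt_iter1 n.
  by move=> /le_trans; apply; apply: le_trans sn1; rewrite lerD2r.
rewrite -(subnK nm) {nm sm1}; elim: (m - n)%N => [|j IH].
  by rewrite !subrr; exact: nu0.
rewrite addSn -(subrKA (sqrt_iter x (j + n))).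
have [_ dj] := sqrt_iter_bounds (j + n) x1.
apply: (le_trans (nuD _ _)); lra.
Qed.

Lemma sqrt_iter_residue x n : nu x <= 1 ->
  nu (1 - x - (1 - sqrt_iter x n) ^+ 2) <= 2 * (2 / n.+2%:R).
Proof.
move=> x1; have -> : 1 - x - (1 - sqrt_iter x n) ^+ 2
    = - (sqrt_iter x n.+1 - sqrt_iter x n) - (sqrt_iter x n.+1 - sqrt_iter x n).
  rewrite [sqrt_iter x n.+1]/=; set s := sqrt_iter x n.
  transitivity (s + s - (half + half) * (x + s ^+ 2)); last by ring.
  by rewrite halfE; ring.
have dn := sqrt_iter_cauchy x1 (leqnSn n).
apply: (le_trans (nuB _ _)); have := nuN (sqrt_iter x n.+1 - sqrt_iter x n).
set e := 2 / _ in dn *; lra.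
Qed.

Lemma rate_le (e : R) : 0 < e ->
  exists N, forall n, (N <= n)%N -> 2 / n.+2%:R <= e.
Proof.
move=> e0; exists (Num.bound (2 / e)) => n Nn.
rewrite ler_pdivrMr// -ler_pdivrMl// mulrC ltW//.
have /lt_trans -> // : 2 / e < (Num.bound (2 / e))%:R.
  by apply: archi_boundP; rewrite divr_ge0// ltW.
by rewrite ltr_nat; exact: leq_ltn_trans Nn _.
Qed.

(** In norm at most 1, the element 1 - x is positive in the only sense that is
    used: it is a limit of squares. *)
Lemma approx_sqrt x e : nu x <= 1 -> 0 < e ->
  exists y, nu (1 - x - y ^+ 2) <= e.
Proof.
move=> x1 e0; have e2 : 0 < e / 2 by rewrite divr_gt0.
have [n /(_ _ (leqnn n)) ne] := rate_le e2.
exists (1 - sqrt_iter x n); apply: (le_trans (sqrt_iter_residue n x1)).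
by rewrite mulrC -ler_pdivlMr.
Qed.

(** If y is nearly a square root of 1 - q^2 then y^2 + q^2 is nearly 1, so the
    hypothesis on sums of squares bounds y, hence 1 - q^2. *)
Lemma nu_sqr_le1 q : nu q <= 1 -> nu (1 - q ^+ 2) <= 1.
Proof.
move=> q1; apply/ler_addgt0Pr => e e0.
have q21 : nu (q ^+ 2) <= 1.
  by rewrite expr2; apply: (le_trans (nuM _ _)); rewrite mulr_ile1.
have e2 : 0 < e / 2 by rewrite divr_gt0.
have [y ye] := approx_sqrt q21 e2.
have nu_y2 : nu (y ^+ 2) <= 1 + e / 2.
  rewrite expr2; apply: (le_trans (nuM _ _)); rewrite -expr2.
  apply: (le_trans (nu_sqr y q)).
  rewrite (_ : _ + _ = 1 - (1 - q ^+ 2 - y ^+ 2)); last by ring.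
  by apply: (le_trans (nuB _ _)); exact: lerD nu1 ye.
rewrite (_ : _ - _ = y ^+ 2 + (1 - q ^+ 2 - y ^+ 2)); last by ring.
apply: (le_trans (nuD _ _)); lra.
Qed.

(** With h = k^2 the spectrum lies in [0, 1], and the functions below converge
    to max (h - 9/10, 0), written as w + |w| with w = (h - 9/10) / 2. The
    truncation level is close to 1 so that this limit is small. *)
Section cutoff_construction.
Variable k : E.
Hypothesis nuk : nu k = 1.
Let th : E := cst (9 / 10).
Let W : E := half * (k ^+ 2 - th).
Let rt n : E := 1 - sqrt_iter (1 - W ^+ 2) n.

Definition cutoff n : E := W + rt n.

Let nu_k2 : nu (k ^+ 2) <= 1.
Proof. by rewrite expr2; apply: (le_trans (nuM _ _)); rewrite nuk mulr1. Qed.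

Let nu_W : nu W <= 1.
Proof.
apply: (le_trans (nuZ _ _)); rewrite ger0_norm ?invr_ge0//.
have := nuB (k ^+ 2) th; have := nu_cst (9 / 10); rewrite -/th ger0_norm; last lra.
have := nu_k2; lra.
Qed.

Let nu_x : nu (1 - W ^+ 2) <= 1.
Proof. exact: nu_sqr_le1. Qed.

Let nu_rt n : nu (rt n) <= 2.
Proof.
have [s1 _] := sqrt_iter_bounds n nu_x; have [_ s2 _] := sqrt_iter1_bounds n.
have n1 := nu1; apply: (le_trans (nuB _ _)); lra.
Qed.

Let W2 : W + W = k ^+ 2 - th.
Proof. by rewrite /W -mulrDl halfE mul1r. Qed.

Lemma cutoff_cauchy n m : (n <= m)%N ->
  nu (cutoff m - cutoff n) <= 2 / n.+2%:R.
Proof.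
move=> nm; rewrite (_ : cutoff m - cutoff n = - (sqrt_iter (1 - W ^+ 2) m
  - sqrt_iter (1 - W ^+ 2) n)); last by rewrite /cutoff /rt; ring.
exact: le_trans (nuN _) (sqrt_iter_cauchy nu_x nm).
Qed.

Let rt_residue n : nu (W ^+ 2 - rt n ^+ 2) <= 2 * (2 / n.+2%:R).
Proof. by have := sqrt_iter_residue n nu_x; rewrite opprB addrCA subrr addr0. Qed.

(** The limit f satisfies w |w| = w^2 on its support, that is
    (h - 9/10) f = f^2; the defect is the difference w^2 - r^2 for the
    approximate square root r. *)
Lemma cutoff_eq n :
  nu (k ^+ 2 * cutoff n - th * cutoff n - cutoff n ^+ 2) <= 2 * (2 / n.+2%:R).
Proof.
rewrite -mulrBl -W2 (_ : _ - _ = W ^+ 2 - rt n ^+ 2); first exact: rt_residue.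
by rewrite /cutoff; ring.
Qed.

Let nu_cutoff n : nu (cutoff n) <= 3.
Proof. have := nu_W; have := nu_rt n; have := nuD W (rt n); rewrite /cutoff; lra. Qed.

Let rt_sqrt n e : 0 < e -> exists g, nu (rt n - g ^+ 2) <= e.
Proof.
apply: approx_sqrt; have [s1 _] := sqrt_iter_bounds n nu_x.
by have [_ s2 _] := sqrt_iter1_bounds n; exact: le_trans s1 s2.
Qed.

Let k2E : k ^+ 2 = W + W + th.
Proof. by rewrite W2 subrK. Qed.

(** Since h <= 1, the limit f satisfies 1 - h = 1/10 - (h - 9/10) >= 0, whence
    f^4 = (h - 9/10) f^3 <= f^3 / 10. Positivity enters through squares:
    2 (f^4 + (v f g)^2) = f^4 + f^3 / 10 when v^2 = 1 - h and g^2 = |w|. *)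
Lemma cutoff_small n : 2 * (2 / n.+2%:R) <= 1 / 4000 :> R -> nu (cutoff n) <= 1 / 2.
Proof.
set e : R := 1 / 4000 => ne; have e0 : 0 < e by rewrite /e; lra.
have [v va] := approx_sqrt nu_k2 e0; have [g gb] := rt_sqrt n e0.
have := le_trans (rt_residue n) ne; have := nu_cutoff n.
have : nu (v ^+ 2) <= 3.
  rewrite (_ : v ^+ 2 = 1 - k ^+ 2 - (1 - k ^+ 2 - v ^+ 2)); last by ring.
  have := nuB (1 - k ^+ 2) (1 - k ^+ 2 - v ^+ 2); have := nuB 1 (k ^+ 2).
  have := nu1; have := nu_k2; rewrite /e in va; lra.
have F0 := nu_ge0 (cutoff n).
rewrite -/(rt n) in gb; set r := rt n in gb *.
set f := cutoff n in F0 *; set F := nu f in F0 *.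
set a := _ - v ^+ 2 in va; set b := _ - g ^+ 2 in gb.
set d := W ^+ 2 - _ => v3 F3 de.
have nuf m : nu (f ^+ m.+1) <= F ^+ m.+1.
  elim: m => [//|m IH]; rewrite exprS [leRHS]exprS.
  by apply: (le_trans (nuM _ _)); rewrite ler_wpM2l.
(* The residues a, b, d collect the defects of v, g and r as square roots. *)
have pq : (f ^+ 2) ^+ 2 + (v * f * g) ^+ 2 = half * (f ^+ 4 + (1 - th) * f ^+ 3
    - (d * f ^+ 2 + a * f ^+ 3 + v ^+ 2 * (d * f + (b + b) * f ^+ 2))).
  rewrite -[LHS]mul1r -{1}halfE mulrDl -mulrDr; congr (_ * _).
  by rewrite /a k2E /b /d /f /cutoff -/r; ring.
have F4 : F ^+ 4 <= nu ((f ^+ 2) ^+ 2 + (v * f * g) ^+ 2).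
  apply: le_trans (nu_sqr _ _); rewrite (exprM F 2 2).
  by rewrite ler_sqr ?nnegrE ?exprn_ge0//; exact: nu_sqr_le.
have nuc : nu (1 - th) <= 1 / 10.
  rewrite -(rmorph1 cst) -rmorphB; apply: (le_trans (nu_cst _)).
  by rewrite ger0_norm; lra.
have nu_err : nu (d * f ^+ 2 + a * f ^+ 3 + v ^+ 2 * (d * f + (b + b) * f ^+ 2))
    <= e * (F ^+ 2 + F ^+ 3 + 3 * (F + 2 * F ^+ 2)).
  have step p q (x y : R) : nu p <= x -> nu q <= y -> nu (p * q) <= x * y.
    by move=> px qy; apply: (le_trans (nuM _ _)); exact: ler_pM.
  have b2 : nu (b + b) <= e * 2 by apply: (le_trans (nuD _ _)); lra.
  have t1 := step _ _ _ _ de (nuf 1%N); have t2 := step _ _ _ _ va (nuf 2%N).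
  have t3 := step _ _ _ _ de (nuf 0%N); have t4 := step _ _ _ _ b2 (nuf 1%N).
  have t5 := step _ _ _ _ v3 (le_trans (nuD _ _) (lerD t3 t4)).
  rewrite expr1 in t5.
  have := le_trans (nuD _ _) (lerD (le_trans (nuD _ _) (lerD t1 t2)) t5).
  by move=> /le_trans; apply; rewrite le_eqVlt; apply/orP; left; apply/eqP; ring.
have {pq F4 nu_err} F4 :
    F ^+ 4 <= 1 / 10 * F ^+ 3 + e * (F ^+ 2 + F ^+ 3 + 3 * (F + 2 * F ^+ 2)).
  have := le_trans (nuM _ _) (ler_pM (nu_ge0 _) (nu_ge0 _) nuc (nuf 2%N)).
  have := nuf 3%N; move: F4 nu_err; rewrite pq.
  set A := f ^+ 4; set B := (1 - th) * _; set D := d * _ + _ + _.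
  have := nuZ 2^-1 (A + B - D); rewrite ger0_norm ?invr_ge0//.
  have := nuB (A + B) D; have := nuD A B; rewrite -/half; lra.
(* If F > 1/2 then F^3 (F - 1/10) > 1/20, whereas the error terms add up to
   at most 99 / 4000 because F <= 3. *)
rewrite leNgt; apply/negP => F12.
have F32 : 9 * F <= 27 by lra.
have : F ^+ 2 <= 9 by nra.
have : F ^+ 3 <= 27 by rewrite exprS; nra.
have : 1 / 8 < F ^+ 3 by rewrite exprS expr2; nra.
move: F4; rewrite [F ^+ 4]exprS /e; nra.
Qed.

(** If f were small then |w| = f - w would be nearly - w, so k^2 + |w| would be
    nearly h - w = (h + 9/10) / 2, of norm at most 19/20; but |w| is nearly a
    square, so the norm of k^2 + |w| is at least that of k^2. *)
Lemma cutoff_large n : 1 / 40 <= nu (cutoff n).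
Proof.
have e0 : 0 < 1 / 40 :> R by lra.
have [g gb] := rt_sqrt n e0.
have := nu_sqr k g; rewrite nuk expr1n.
have -> : k ^+ 2 + g ^+ 2
    = half * (k ^+ 2 + th) + cutoff n - (rt n - g ^+ 2).
  have -> : half * (k ^+ 2 + th) = (half + half) * (W + th) by rewrite k2E; ring.
  by rewrite halfE k2E /cutoff; ring.
have := nuB (half * (k ^+ 2 + th) + cutoff n) (rt n - g ^+ 2).
have := nuD (half * (k ^+ 2 + th)) (cutoff n).
have := nuZ 2^-1 (k ^+ 2 + th); rewrite ger0_norm ?invr_ge0// -/half.
have := nuD (k ^+ 2) th; have := nu_cst (9 / 10); rewrite -/th ger0_norm; last lra.
have := nu_k2; lra.
Qed.

Lemma exists_cutoff : exists f : nat -> E,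
  [/\ forall n m, (n <= m)%N -> nu (f m - f n) <= 2 / n.+2%:R,
      forall n, nu (k ^+ 2 * f n - cst (9 / 10) * f n - f n ^+ 2)
                <= 2 * (2 / n.+2%:R),
      exists N, forall n, (N <= n)%N -> nu (f n) <= 1 / 2 &
      forall n, 1 / 40 <= nu (f n)].
Proof.
exists cutoff; split.
- exact: cutoff_cauchy.
- exact: cutoff_eq.
- have e0 : 0 < 1 / 8000 :> R by lra.
  have [N HN] := rate_le e0; exists N => n /HN le_n; apply: cutoff_small.
  by set t : R := 2 / _ in le_n *; lra.
- exact: cutoff_large.
Qed.

End cutoff_construction.
End real_function_seminorm.

(** * The real valued norm *)

Section real_norm.
Variables (R : realType) (A : cstarAlgType R).
Implicit Types (a b x y : A) (r : R).

Definition nrm a : R := complex.Re `|a|.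

Lemma nrmE a : `|a| = (nrm a)%:C%C.
Proof. by rewrite /nrm RRe_real// ger0_real. Qed.

Lemma nrm_ge0 a : 0 <= nrm a.
Proof. by rewrite -lecR -nrmE normr_ge0. Qed.

Lemma nrm0 : nrm 0 = 0.
Proof. by rewrite /nrm normr0. Qed.

Lemma nrm_eq0 a : nrm a = 0 -> a = 0.
Proof. by move=> a0; apply: normr0_eq0; rewrite nrmE a0. Qed.

Lemma nrmD a b : nrm (a + b) <= nrm a + nrm b.
Proof. by rewrite -lecR rmorphD /= -!nrmE ler_normD. Qed.

Lemma nrmN a : nrm (- a) = nrm a.
Proof. by rewrite /nrm normrN. Qed.

Lemma nrmB a b : nrm (a - b) <= nrm a + nrm b.
Proof. by rewrite -(nrmN b) nrmD. Qed.

Lemma nrmBC a b : nrm (a - b) = nrm (b - a).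
Proof. by rewrite -nrmN opprB. Qed.

Lemma nrmZ r a : nrm (r%:C%C *: a) = `|r| * nrm a.
Proof.
rewrite {1}/nrm normrZ nrmE normc_def /= expr0n addr0 sqrtr_sqr.
by rewrite mul0r subr0.
Qed.

Lemma nrmM a b : nrm (a ** b) <= nrm a * nrm b.
Proof. by rewrite -lecR rmorphM /= -!nrmE ler_norm_cmul. Qed.

Lemma nrm_star_mul a : nrm (a^# ** a) = nrm a ^+ 2.
Proof. by apply: complexI; rewrite /= -nrmE norm_cstar_cmul nrmE rmorphXn. Qed.

Lemma nrm_star a : nrm a^# = nrm a.
Proof.
suff le_star b : nrm b <= nrm b^#.
  by apply/eqP; rewrite eq_le le_star -{2}(cstarK a) le_star.
have := nrmM b^# b; rewrite nrm_star_mul expr2.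
have [->|b0] := eqVneq (nrm b) 0; first by rewrite nrm_ge0.
by rewrite ler_pM2r// lt_def b0 nrm_ge0.
Qed.

Lemma cstar0 : (0 : A)^# = 0.
Proof. by apply: nrm_eq0; rewrite nrm_star nrm0. Qed.

Lemma cstarN a : (- a)^# = - a^#.
Proof. by apply/eqP; rewrite -addr_eq0 -cstarD addNr cstar0. Qed.

Lemma cstarZr r a : (r%:C%C *: a)^# = r%:C%C *: a^#.
Proof. by rewrite cstarZ; congr (_ *: _); apply/conj_Creal/complex_realP; exists r. Qed.

Lemma cmul0l a : 0 ** a = 0.
Proof. by rewrite -[X in X ** _](scale0r (0 : A)) cmulZl scale0r. Qed.

Lemma cmul0r a : a ** 0 = 0.
Proof. by rewrite -[X in _ ** X](scale0r (0 : A)) cmulZr scale0r. Qed.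

End real_norm.

(** * Real polynomials of a self-adjoint element *)

Section real_functional_calculus.
Variables (R : realType) (A : cstarAlgType R) (k : A).
Implicit Types (a b x y : A) (p q : {poly R}) (r : R).

(** The value of p at k, as an operator of left multiplication on A; constant
    terms make sense there although A may have no unit. *)
Definition pact p x : A := \sum_(i < size p) (p`_i)%:C%C *: iter i (cmul k) x.

Lemma pact_widen p n x : (size p <= n)%N ->
  pact p x = \sum_(i < n) (p`_i)%:C%C *: iter i (cmul k) x.
Proof.
move=> pn; rewrite /pact.
rewrite (big_ord_widen n (fun i => (p`_i)%:C%C *: iter i (cmul k) x))//.
rewrite big_mkcond; apply: eq_bigr => i _; case: ltnP => // ip.
by rewrite nth_default// scale0r.
Qed.

Lemma pactD p q x : pact (p + q) x = pact p x + pact q x.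
Proof.
pose n := maxn (size p) (size q).
rewrite (@pact_widen _ n) ?size_polyD// (@pact_widen p n) ?leq_maxl//.
rewrite (@pact_widen q n) ?leq_maxr// -big_split; apply: eq_bigr => i _ /=.
by rewrite coefD rmorphD scalerDl.
Qed.

Lemma pactC r x : pact r%:P x = r%:C%C *: x.
Proof. by rewrite (@pact_widen _ 1) ?size_polyC_leq1// big_ord1 coefC. Qed.

Lemma pactMX p x : pact (p * 'X) x = k ** pact p x.
Proof.
rewrite (@pact_widen _ (size p).+1) ?size_mulX_leq//; last first.
  by have [->|p0] := eqVneq p 0; rewrite ?mul0r ?size_poly0// size_mulX.
rewrite big_ord_recl coefMX /= scale0r add0r.
rewrite /pact (big_morph (cmul k) (cmulDr k) (cmul0r k)); apply: eq_bigr => i _.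
by rewrite coefMX /= cmulZr.
Qed.

Lemma pactZ p (c : R[i]) x : pact p (c *: x) = c *: pact p x.
Proof.
elim/poly_ind: p => [|p r IH]; first by rewrite /pact size_poly0 !big_ord0 scaler0.
by rewrite !pactD !pactMX !pactC IH cmulZr scalerDr !scalerA (mulrC c).
Qed.

Lemma pactM p q x : pact (p * q) x = pact p (pact q x).
Proof.
elim/poly_ind: p x => [|p r IH] x.
  by rewrite mul0r /pact size_poly0 !big_ord0.
rewrite mulrDl -mulrA ['X * q]mulrC mulrA !pactD !pactMX IH pactC; congr (_ + _).
elim/poly_ind: q x {IH} => [|q s IH] x.
  by rewrite mulr0 /pact size_poly0 !big_ord0 scaler0.
rewrite mulrDr mulrA -polyCM !pactD !pactMX IH !pactC cmulZr scalerDr scalerA.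
by rewrite rmorphM.
Qed.

Lemma pact_cmul p x y : pact p (x ** y) = pact p x ** y.
Proof.
elim/poly_ind: p => [|p r IH]; first by rewrite /pact size_poly0 !big_ord0 cmul0l.
by rewrite !pactD !pactMX !pactC IH cmulDl cmulA cmulZl.
Qed.

Hypothesis k_star : k^# = k.

Lemma pact_star p x y : (pact p x)^# ** y = x^# ** pact p y.
Proof.
elim/poly_ind: p x y => [|p r IH] x y.
  by rewrite /pact size_poly0 !big_ord0 cstar0 cmul0l cmul0r.
rewrite !pactD !pactMX !pactC cstarD cstarM cstarZr cmulDl cmulDr cmulZl cmulZr.
rewrite k_star -cmulA IH; congr (_ ** _ + _).
have := pactM 'X p y; rewrite mulrC pactM.
have pX z : pact 'X z = k ** z by rewrite -['X]mul1r pactMX pactC scale1r.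
by rewrite !pX.
Qed.

Let pact_bounded p : exists M, forall x, nrm (pact p x) <= M * nrm x.
Proof.
elim/poly_ind: p => [|p r [M IH]].
  by exists 0 => x; rewrite /pact size_poly0 big_ord0 nrm0 mul0r.
exists (nrm k * M + `|r|) => x; rewrite pactD pactMX pactC.
apply: (le_trans (nrmD _ _)); rewrite nrmZ mulrDl lerD2r -mulrA.
by apply: (le_trans (nrmM _ _)); rewrite ler_wpM2l// nrm_ge0.
Qed.

Definition opnorm p : R := sup [set nrm (pact p x) | x in [set x | nrm x <= 1]].

Let has_sup_op p : has_sup [set nrm (pact p x) | x in [set x | nrm x <= 1]].
Proof.
split; first by exists (nrm (pact p 0)), 0 => //=; rewrite nrm0.
have [M pM] := pact_bounded p; exists `|M| => _ [x /= x1 <-].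
apply: (le_trans (pM x)); apply: (le_trans (ler_wpM2r (nrm_ge0 _) (ler_norm M))).
by rewrite ler_piMr.
Qed.

Lemma nrm_pact p x : nrm (pact p x) <= opnorm p * nrm x.
Proof.
have [x0|x0] := eqVneq (nrm x) 0.
  have [M pM] := pact_bounded p.
  by have := pM x; rewrite x0 !mulr0.
have xgt0 : 0 < nrm x by rewrite lt_def x0 nrm_ge0.
rewrite -ler_pdivrMr// mulrC -[X in X * _]ger0_norm ?invr_ge0 ?nrm_ge0//.
rewrite -nrmZ; apply: sup_upper_bound; first exact: has_sup_op.
exists (((nrm x)^-1)%:C%C *: x) => /=.
  by rewrite nrmZ ger0_norm ?invr_ge0 ?nrm_ge0// mulVf.
by rewrite pactZ.
Qed.

Lemma opnorm_le p M : (forall x, nrm x <= 1 -> nrm (pact p x) <= M) -> opnorm p <= M.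
Proof.
by move=> pM; apply: ge_sup; [case: (has_sup_op p)|move=> _ [x /= /pM ? <-]].
Qed.

Lemma opnorm_ge0 p : 0 <= opnorm p.
Proof.
apply: le_trans (nrm_ge0 (pact p 0)) _; apply: sup_upper_bound => //.
by exists 0 => //=; rewrite nrm0.
Qed.

Lemma opnormD p q : opnorm (p + q) <= opnorm p + opnorm q.
Proof.
apply: opnorm_le => x x1; rewrite pactD; apply: (le_trans (nrmD _ _)).
by rewrite lerD//; apply: (le_trans (nrm_pact _ _)); rewrite ler_piMr ?opnorm_ge0.
Qed.

Lemma opnormM p q : opnorm (p * q) <= opnorm p * opnorm q.
Proof.
apply: opnorm_le => x x1; rewrite pactM; apply: (le_trans (nrm_pact _ _)).
rewrite ler_wpM2l ?opnorm_ge0//; apply: (le_trans (nrm_pact _ _)).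
by rewrite ler_piMr ?opnorm_ge0.
Qed.

Lemma opnormC r : opnorm r%:P <= `|r|.
Proof. by apply: opnorm_le => x x1; rewrite pactC nrmZ ler_piMr. Qed.

(** For z = p x + i q x and its companion z' = p x - i q x, both z^* z and
    z'^* z' are x^* (p^2 + q^2) x, because the cross terms cancel; and p x is
    the half sum of z and z'. *)
Lemma opnorm_sqr p q : opnorm p ^+ 2 <= opnorm (p ^+ 2 + q ^+ 2).
Proof.
set M := opnorm (_ + _); have M0 : 0 <= M := opnorm_ge0 _.
rewrite -(sqr_sqrtr M0) ler_sqr ?nnegrE ?opnorm_ge0 ?sqrtr_ge0//.
apply: opnorm_le => x x1.
have nrm_z (c : R[i]) : c = 'i \/ c = - 'i ->
    nrm (pact p x + c *: pact q x) <= Num.sqrt M.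
  move=> ci; rewrite -[leLHS]ger0_norm ?nrm_ge0// -sqrtr_sqr ler_sqrt// -nrm_star_mul.
  suff -> : (pact p x + c *: pact q x)^# ** (pact p x + c *: pact q x)
      = x^# ** pact (p ^+ 2 + q ^+ 2) x.
    apply: (le_trans (nrmM _ _)); rewrite nrm_star.
    apply: (le_trans (ler_pM (nrm_ge0 _) (nrm_ge0 _) x1 (nrm_pact _ _))).
    by rewrite mul1r ler_piMr.
  have cc : Num.conj c * c = 1.
    by rewrite -normCKC; case: ci => ->; rewrite ?normrN normCi expr1n.
  have cN : Num.conj c + c = 0.
    by case: ci => ->; rewrite ?rmorphN /= (@conjCi R[i]) ?opprK ?addNr ?addrN.
  rewrite cstarD cstarZ cmulDl !cmulDr !cmulZl !cmulZr !pact_star -!pactM scalerA cc.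
  rewrite scale1r (mulrC q p) -addrA [c *: _ + _]addrA -scalerDl [c + _]addrC cN.
  by rewrite scale0r add0r -!expr2 pactD cmulDr.
have -> : pact p x = (2^-1)%:C%C *: ((pact p x + 'i *: pact q x)
    + (pact p x + - 'i *: pact q x)).
  rewrite scaleNr addrACA subrr addr0 scalerDr -scalerDl.
  by rewrite -rmorphD (_ : _ + _ = 1) ?rmorph1 ?scale1r//; lra.
have := nrm_z 'i (or_introl erefl); have := nrm_z (- 'i) (or_intror erefl).
rewrite nrmZ ger0_norm ?invr_ge0//.
have := nrmD (pact p x + 'i *: pact q x) (pact p x + - 'i *: pact q x); lra.
Qed.


(** The supremum of the operator norm and of the evaluation at 0. The second
    term keeps track of constant terms, which the operator norm does not
    determine apart from the rest when A has a unit. *)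
Definition cnorm p : R := Num.max `|p.[0]| (opnorm p).

Lemma cnorm_exists_cutoff : nrm k = 1 -> exists f : nat -> {poly R},
  [/\ forall n m, (n <= m)%N -> cnorm (f m - f n) <= 2 / n.+2%:R,
      forall n, cnorm ('X ^+ 2 * f n - (9 / 10)%:P * f n - f n ^+ 2)
                <= 2 * (2 / n.+2%:R),
      exists N, forall n, (N <= n)%N -> cnorm (f n) <= 1 / 2 &
      forall n, 1 / 40 <= cnorm (f n)].
Proof.
move=> k1.
have [||||||f [f1 f2 f3 f4]] := @exists_cutoff R {poly R} cnorm _ _ _ _ _ 'X.
- by move=> p; rewrite le_max normr_ge0.
- move=> p q; rewrite ge_max hornerD; apply/andP; split.
    by apply: (le_trans (ler_normD _ _)); rewrite lerD// le_max lexx.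
  by apply: (le_trans (opnormD _ _)); rewrite lerD// le_max lexx orbT.
- move=> p q; rewrite ge_max hornerM normrM; apply/andP; split.
    by rewrite ler_pM// le_max lexx.
  apply: (le_trans (opnormM _ _)).
  by rewrite ler_pM ?opnorm_ge0// le_max lexx orbT.
- by move=> a; rewrite /= alg_polyC ge_max hornerC lexx opnormC.
- move=> p q; rewrite /cnorm maxEle; case: ifP => _.
    apply: (le_trans (opnorm_sqr p q)); by rewrite le_max lexx orbT.
  rewrite le_max hornerD !horner_exp real_normK ?num_real//.
  by rewrite ger0_norm ?addr_ge0 ?sqr_ge0// lerDl sqr_ge0.
- apply/eqP; rewrite eq_le ge_max le_max hornerX normr0 ler01/=; apply/andP; split.
    apply: opnorm_le => x x1; rewrite -['X]mul1r pactMX pactC scale1r.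
    by apply: (le_trans (nrmM _ _)); rewrite k1 mul1r.
  apply/orP; right.
  have := nrm_pact 'X k; rewrite -['X]mul1r pactMX pactC scale1r k1 mulr1 mul1r.
  by rewrite -{1}k_star nrm_star_mul k1 expr1n.
by exists f; split=> // n; have := f2 n; rewrite /= alg_polyC.
Qed.

End real_functional_calculus.

(** * Closures and limits through the real norm *)

Section real_norm_topology.
Variables (R : realType) (A : cstarAlgType R).
Implicit Types (x y : A) (D : set A).

Lemma closure_nrmP D x :
  closure D x <-> forall e : R, 0 < e -> exists2 y, D y & nrm (x - y) < e.
Proof.
split=> [Dx e e0|Dx B /nbhs_normP[e /= e0 eB]].
  have e0' : 0 < e%:C%C :> R[i] by rewrite ltcR.
  have [y [Dy]] := Dx _ (nbhsx_ballx x (e%:C%C) e0').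
  by rewrite -ball_normE /ball_ /= nrmE ltcR => ye; exists y.
have eE : e = (complex.Re e)%:C%C by rewrite RRe_real// gtr0_real.
have /Dx[y Dy xy] : 0 < complex.Re e by move: e0; rewrite eE ltcR.
by exists y; split=> //; apply: eB; rewrite /ball_ /= nrmE eE ltcR.
Qed.

Lemma closed_nrm D x : closed D ->
  (forall e : R, 0 < e -> exists2 y, D y & nrm (x - y) < e) -> D x.
Proof. by move=> cD Dx; apply: cD; apply/closure_nrmP. Qed.

Lemma exists_limit D (u : nat -> A) (r : nat -> R) : closed D ->
  (forall n, D (u n)) ->
  (forall e, 0 < e -> exists N, forall n, (N <= n)%N -> r n <= e) ->
  (forall n m, (n <= m)%N -> nrm (u m - u n) <= r n) ->
  exists2 l, D l & forall n, nrm (l - u n) <= r n.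
Proof.
move=> cD Du r0 ur.
have cu : cvg (u @ \oo).
  apply: cauchy_cvg; apply: cauchy_exP => e e0.
  have eE : e = (complex.Re e)%:C%C by rewrite RRe_real// gtr0_real.
  have e0' : 0 < complex.Re e / 2 by rewrite divr_gt0// -ltcR -eE.
  have [N /(_ _ (leqnn N)) HN] := r0 _ e0'.
  exists (u N), N => //= n Nn; rewrite -ball_normE /ball_ /= nrmE eE ltcR nrmBC.
  by apply: le_lt_trans (ur _ _ Nn) (le_lt_trans HN _); lra.
have ul (e : R) : 0 < e ->
    exists N, forall n, (N <= n)%N -> nrm (lim (u @ \oo) - u n) < e.
  move=> e0; have e0' : 0 < e%:C%C :> R[i] by rewrite ltcR.
  have /cvgrPdist_lt/(_ _ e0')[N _ HN] := cu.
  by exists N => n /HN /=; rewrite nrmE ltcR.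
exists (lim (u @ \oo)) => [|n].
  apply: closed_nrm => // e /ul[N /(_ _ (leqnn N)) HN].
  by exists (u N).
apply/ler_addgt0Pr => e /ul[N HN].
rewrite -(subrKA (u (maxn N n))); apply: (le_trans (nrmD _ _)).
by rewrite addrC lerD ?ur ?leq_maxr// ltW// HN// leq_maxl.
Qed.

End real_norm_topology.

(** * Distance to a subalgebra *)

Section distance.
Variables (R : realType) (A : cstarAlgType R) (I : subCstarAlg A).
Implicit Types x y : A.

Definition dist x : R := inf [set nrm (x + y) | y in carrier I].

Let has_inf_dist x : has_inf [set nrm (x + y) | y in carrier I].
Proof.
split; first by exists (nrm (x + 0)), 0 => //; exact: carrier0.
by exists 0 => _ [y _ <-]; exact: nrm_ge0.
Qed.

Lemma dist_le x y : carrier I y -> dist x <= nrm (x + y).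
Proof. by move=> Iy; apply: ge_inf; [case: (has_inf_dist x)|exists y]. Qed.

Lemma dist_approx x e : 0 < e -> exists2 y, carrier I y & nrm (x + y) < dist x + e.
Proof.
by move=> /(inf_adherent)/(_ (has_inf_dist x))[_ [y Iy <-] ye]; exists y.
Qed.

Lemma dist_ge0 x : 0 <= dist x.
Proof.
by apply: lb_le_inf; [case: (has_inf_dist x)|move=> _ [y _ <-]; exact: nrm_ge0].
Qed.

Lemma dist_le_nrm x : dist x <= nrm x.
Proof. by have := dist_le x (carrier0 I); rewrite addr0. Qed.

Lemma distD x y : dist (x + y) <= dist x + dist y.
Proof.
apply/ler_addgt0Pr => e e0; have e2 : 0 < e / 2 by rewrite divr_gt0.
have [u Iu xu] := dist_approx x e2; have [v Iv yv] := dist_approx y e2.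
apply: le_trans (dist_le _ (carrierD Iu Iv)) _; rewrite addrACA.
by apply: (le_trans (nrmD _ _)); lra.
Qed.

Lemma distZ r x : dist (r%:C%C *: x) <= `|r| * dist x.
Proof.
apply/ler_addgt0Pr => e e0; have r1 : 0 < `|r| + 1 by rewrite ltr_wpDl.
have [u Iu xu] := dist_approx x (divr_gt0 e0 r1).
apply: le_trans (dist_le _ (carrierZ r%:C%C Iu)) _.
rewrite -scalerDr nrmZ; apply: (le_trans (ler_wpM2l (normr_ge0 r) (ltW xu))).
rewrite mulrDr lerD2l mulrCA ger_pMr// ler_pdivrMr// mul1r lerDl//.
Qed.

Lemma dist_le0 x : dist x <= 0 -> carrier I x.
Proof.
move=> x0; apply: closed_nrm; first exact: carrier_closed.
move=> e e0; have [y Iy xy] := dist_approx x e0.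
exists (- y); first by rewrite -scaleN1r; exact: carrierZ.
by rewrite opprK; lra.
Qed.

(** When x and y multiply I into itself, the quotient seminorm is
    submultiplicative on them, as
    (x + u) (y + v) differs from x y by an element of I. *)
Lemma distM x y : (forall z, carrier I z -> carrier I (x ** z)) ->
  (forall z, carrier I z -> carrier I (z ** y)) ->
  dist (x ** y) <= dist x * dist y.
Proof.
move=> xI Iy; apply/ler_addgt0Pr => e e0.
have dx0 := dist_ge0 x; have dy0 := dist_ge0 y.
pose d := Num.min 1 (e / (1 + dist x + dist y)).
have s0 : 0 < 1 + dist x + dist y by lra.
have d0 : 0 < d by rewrite lt_min ltr01 divr_gt0.
have d1 : d <= 1 by rewrite ge_min lexx.
have de : d * (1 + dist x + dist y) <= e by rewrite -ler_pdivlMr// ge_min lexx orbT.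
have [u Iu xu] := dist_approx x d0; have [v Iv yv] := dist_approx y d0.
have Iuv : carrier I (x ** v + u ** y + u ** v).
  by apply: carrierD; [apply: carrierD; [exact: xI|exact: Iy]|exact: carrierM].
apply: (le_trans (dist_le _ Iuv)).
have -> : x ** y + (x ** v + u ** y + u ** v) = (x + u) ** (y + v).
  by rewrite cmulDl !cmulDr !addrA.
apply: (le_trans (nrmM _ _)).
apply: (le_trans (ler_pM (nrm_ge0 _) (nrm_ge0 _) (ltW xu) (ltW yv))).
suff : d * d <= d by lra.
by rewrite ger_pMr.
Qed.

End distance.

(** * Isometry of the quotient seminorm on a subalgebra disjoint from the ideal *)

Section representing.
Variables (R : realType) (A : cstarAlgType R) (C : subCstarAlg A) (k : A).
Hypotheses (Ck : carrier C k) (k_star : k^# = k).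
Implicit Types (p q : {poly R}) (b x : A).

(** The operator p(k) is left multiplication by b plus the scalar p(0). *)
Definition represents p b :=
  forall x, pact k p x = b ** x + (p.[0])%:C%C *: x.

Lemma exists_represents p : exists2 b, carrier C b & represents p b.
Proof.
elim/poly_ind: p => [|p r _].
  exists 0; first exact: carrier0.
  by move=> x; rewrite /pact size_poly0 big_ord0 cmul0l horner0 scale0r addr0.
exists (pact k p k).
  elim/poly_ind: p => [|p s IH].
    by rewrite /pact size_poly0 big_ord0; exact: carrier0.
  by rewrite pactD pactMX pactC; apply: carrierD; [exact: carrierM|exact: carrierZ].
move=> x; rewrite pactD pactM pactC hornerMXaddC mulr0 add0r; congr (_ + _).
by rewrite -['X]mul1r pactMX pactC scale1r pact_cmul.
Qed.

Lemma representsB p q a b : represents p a -> represents q b ->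
  represents (p - q) (a - b).
Proof.
move=> pa qb x; apply: (addIr (pact k q x)); rewrite -pactD subrK pa qb.
by rewrite cmulBl hornerD hornerN rmorphB scalerBl [RHS]addrACA !subrK.
Qed.

Lemma nrm_represents p b : represents p b ->
  nrm b <= opnorm k p + `|p.[0]|.
Proof.
move=> pb; have [b0|b0] := eqVneq (nrm b) 0.
  by rewrite b0 addr_ge0// opnorm_ge0.
have : nrm (b ** b^#) = nrm b * nrm b.
  by rewrite -{1}(cstarK b) nrm_star_mul nrm_star expr2.
have -> : b ** b^# = pact k p b^# - (p.[0])%:C%C *: b^# by rewrite pb addrK.
move=> bb; rewrite -(@ler_pM2r _ (nrm b)) ?lt_def ?b0 ?nrm_ge0// -bb.
apply: (le_trans (nrmB _ _)); rewrite nrmZ nrm_star mulrDl lerD2r.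
by have := nrm_pact k p b^#; rewrite nrm_star.
Qed.

Lemma opnorm_represents p b : represents p b ->
  opnorm k p <= nrm b + `|p.[0]|.
Proof.
move=> pb; apply: opnorm_le => x x1; rewrite pb; apply: (le_trans (nrmD _ _)).
rewrite nrmZ lerD// ?ler_piMr//; apply: (le_trans (nrmM _ _)).
by rewrite ler_piMr ?nrm_ge0.
Qed.

Lemma coef0_le_cnorm p : `|p.[0]| <= cnorm k p.
Proof. by rewrite le_max lexx. Qed.

Lemma opnorm_le_cnorm p : opnorm k p <= cnorm k p.
Proof. by rewrite le_max lexx orbT. Qed.

(** Left multiplication by k^2 b - t b - b^2, corrected by the terms coming from
    the constant p(0). *)
Lemma represents_rel p b (t : R) : represents p b ->
  represents ('X ^+ 2 * p - t%:P * p - p ^+ 2)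
    (k ** k ** b + (p.[0])%:C%C *: (k ** k) - t%:C%C *: b
      - (b ** b + (p.[0] + p.[0])%:C%C *: b)).
Proof.
move=> pb; apply: representsB; first apply: representsB.
- move=> x; rewrite pactM pb hornerM expr2 hornerM hornerX !mul0r scale0r addr0.
  rewrite pactM -['X]mul1r !pactMX !pactC !scale1r.
  by rewrite cmulDl cmulZl !cmulDr !cmulZr !cmulA.
- by move=> x; rewrite pactM pactC pb hornerM hornerC rmorphM scalerDr scalerA cmulZl.
- move=> x; rewrite expr2 pactM !pb hornerM rmorphM rmorphD.
  rewrite cmulDr scalerDr cmulZr !scalerA cmulDl cmulZl scalerDl cmulA.
  by rewrite !addrA.
Qed.

Variable I : subCstarAlg A.
Hypothesis CI : forall x y, carrier C x -> carrier I y ->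
  carrier I (x ** y) /\ carrier I (y ** x).
Hypothesis CI0 : forall x, carrier C x -> carrier I x -> x = 0.

Let distMC x y : carrier C x -> carrier C y ->
  dist I (x ** y) <= dist I x * dist I y.
Proof.
by move=> Cx Cy; apply: distM => z Iz; [case: (CI Cx Iz)|case: (CI Cy Iz)].
Qed.

(** For b close to a truncation, 9/10 b = k^2 b - b^2 up to O(e). Modulo I the
    factor k^2 has norm at most 1/100 and b has norm at most about 1/2, so the
    right-hand side is contracting and b is O(e) modulo I. The constant term c
    of p satisfies c (9/10 + c) = O(e). *)
Let dist_cutoff p b (e : R) : nrm k = 1 -> dist I k <= 1 / 10 ->
  carrier C b -> represents p b -> 0 <= e <= 1 / 1000 ->
  cnorm k p <= 1 / 2 ->
  cnorm k ('X ^+ 2 * p - (9 / 10)%:P * p - p ^+ 2) <= e ->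
  `|p.[0]| <= 3 * e /\ dist I b <= 100 * e.
Proof.
move=> k1 dk Cb pb /andP[e0 e1] p12 rel_e.
have c12 := le_trans (coef0_le_cnorm p) p12.
have op12 := le_trans (opnorm_le_cnorm p) p12.
have rel0 := le_trans (coef0_le_cnorm _) rel_e.
have relop := le_trans (opnorm_le_cnorm _) rel_e.
have nrel := nrm_represents (represents_rel (9 / 10) pb).
set w : A := _ - (b ** b + _) in nrel.
have {}nrel : nrm w <= 2 * e by lra.
have c_le : `|p.[0]| <= 3 * e.
  set c := p.[0] in c12 *; move: rel0.
  have -> : ('X ^+ 2 * p - (9 / 10)%:P * p - p ^+ 2).[0] = - ((9 / 10 + c) * c).
    by rewrite !(hornerE, hornerXn, horner_exp) -/c; ring.
  rewrite normrN normrM.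
  have : 4 / 10 <= `|9 / 10 + c|.
    by move: c12; rewrite ler_norml => /andP[? ?]; rewrite ger0_norm; lra.
  have := normr_ge0 c; nra.
split=> //.
set c := p.[0] in c12 c_le w nrel *.
have nb : nrm b <= 1 / 2 + 3 * e.
  have := nrm_represents pb; rewrite -/c; lra.
have := dist_ge0 I b; set D := dist I b => D0.
have kk : dist I (k ** k) <= 1 / 100.
  apply: (le_trans (distMC Ck Ck)).
  by have := ler_pM (dist_ge0 I k) (dist_ge0 I k) dk dk; lra.
have kkb : dist I (k ** k ** b) <= 1 / 100 * D.
  by apply: (le_trans (distMC (carrierM Ck Ck) Cb)); rewrite ler_wpM2r.
have bb : dist I (b ** b) <= (1 / 2 + 3 * e) * D.
  apply: (le_trans (distMC Cb Cb)); rewrite ler_wpM2r//.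
  exact: le_trans (dist_le_nrm _ _) nb.
pose z := c%:C%C *: (k ** k) - (c + c)%:C%C *: b - w.
have nz : nrm z <= 15 * e.
  have t1 : nrm (c%:C%C *: (k ** k)) <= 3 * e.
    rewrite nrmZ; apply: le_trans c_le; rewrite ler_piMr//.
    by apply: (le_trans (nrmM _ _)); rewrite k1 mulr1.
  have t2 : nrm ((c + c)%:C%C *: b) <= 6 * e * 1.
    rewrite nrmZ ler_pM ?nrm_ge0//; last lra.
    by apply: (le_trans (ler_normD _ _)); lra.
  have := nrmB (c%:C%C *: (k ** k) - (c + c)%:C%C *: b) w.
  have := nrmB (c%:C%C *: (k ** k)) ((c + c)%:C%C *: b); rewrite -/z; lra.
(* The inverse 10/9 of the truncation level solves the relation for b. *)
have bE : b = (10 / 9)%:C%C *: (k ** k ** b + - (b ** b) + z).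
  have -> : k ** k ** b + - (b ** b) + z = (9 / 10)%:C%C *: b.
    rewrite /z /w; set u := k ** k ** b; set v := b ** b.
    set c1 := c%:C%C *: _; set c2 := (c + c)%:C%C *: _; set t := (9 / 10)%:C%C *: _.
    rewrite addrA (addrACA u) -opprD; set x := u + c1; set y := v + c2.
    by rewrite opprB opprB addrA subrK addrC subrK.
  by rewrite scalerA -rmorphM (_ : _ * _ = 1) ?scale1r//; lra.
have := distZ I (10 / 9) (k ** k ** b + - (b ** b) + z); rewrite -bE -/D.
rewrite ger0_norm; last lra.
have := distD I (k ** k ** b + - (b ** b)) z; have := dist_le_nrm I z.
have := distD I (k ** k ** b) (- (b ** b)).
have := distZ I (-1) (b ** b); rewrite rmorphN1 scaleN1r normrN1 mul1r.
nra.
Qed.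

(** Otherwise the truncations of k^2 near its maximum tend to an element of C
    which vanishes modulo I; it is 0 since C and I are disjoint, whereas the
    truncations stay away from 0. *)
Lemma dist_selfadjoint_gt : nrm k = 1 -> 1 / 10 < dist I k.
Proof.
move=> k1; rewrite ltNge; apply/negP => dk.
have [f [f_cauchy f_rel [N0 f_small] f_large]] := cnorm_exists_cutoff k_star k1.
have /choice[b Cb] n : exists b, carrier C b /\ represents (f n) b.
  by have [b Cb fb] := exists_represents (f n); exists b.
pose r n : R := 2 / n.+2%:R.
have r0 n : 0 <= r n by rewrite divr_ge0.
have r_le e := @rate_le R e.
have [N1 rN1] : exists N, forall n, (N <= n)%N -> r n <= 1 / 2000.
  by apply: r_le; lra.
pose N := maxn N0 N1.
have est n : (N <= n)%N -> `|(f n).[0]| <= 6 * r n /\ dist I (b n) <= 200 * r n.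
  rewrite geq_max => /andP[n0 n1]; have [Cbn fbn] := Cb n.
  have e01 : 0 <= 2 * r n <= 1 / 1000 by have := rN1 _ n1; have := r0 n; lra.
  have [] := dist_cutoff k1 dk Cbn fbn e01 (f_small _ n0) (f_rel n).
  by lra.
have b_cauchy n m : (n <= m)%N -> nrm (b m - b n) <= 2 * r n.
  move=> nm; have [[_ fn] [_ fm]] := (Cb n, Cb m).
  have := nrm_represents (representsB fm fn); have := f_cauchy _ _ nm.
  have := coef0_le_cnorm (f m - f n); have := opnorm_le_cnorm (f m - f n).
  by rewrite -/(r n); lra.
have r2_le e : 0 < e -> exists N, forall n, (N <= n)%N -> 2 * r n <= e.
  move=> e0; have e2 : 0 < e / 2 by rewrite divr_gt0.
  have [M HM] := r_le _ e2; exists M => n /HM; rewrite -/(r n); lra.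
have [l Cl bl] :=
  exists_limit (@carrier_closed _ _ C) (fun n => (Cb n).1) r2_le b_cauchy.
have l0 : l = 0.
  apply: CI0 => //; apply: dist_le0; apply/ler_addgt0Pr => e e0;
  rewrite add0r; have e3 : 0 < e / 202 by rewrite divr_gt0.
  have [M HM] := r_le _ e3; have nM := HM _ (leq_maxl M N).
  have [_ dn] := est _ (leq_maxr M N); set n := maxn M N in nM dn.
  have := distD I (b n) (l - b n); rewrite addrC subrK.
  have := dist_le_nrm I (l - b n); have := bl n.
  have {}nM : r n <= e / 202 := nM. lra.
have [M HM] := r_le (1 / 400) ltac:(lra).
have nM : r (maxn M N) <= 1 / 400 := HM _ (leq_maxl M N).
have [fn _] := est _ (leq_maxr M N); set n := maxn M N in nM fn.
have := bl n; rewrite l0 sub0r nrmN; have [_ fbn] := Cb n.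
have := opnorm_represents fbn; have := f_large n; rewrite le_max => /orP[]; lra.
Qed.

End representing.

Section isometry.
Variables (R : realType) (A : cstarAlgType R) (C I : subCstarAlg A).
Hypothesis CI : forall x y, carrier C x -> carrier I y ->
  carrier I (x ** y) /\ carrier I (y ** x).
Hypothesis CI0 : forall x, carrier C x -> carrier I x -> x = 0.

(** If the distance were smaller than the norm, the powers a^(2^n) of the
    normalized element would keep norm 1 while their distance to I tends to 0. *)
Let nrm_le_dist_sa a : carrier C a -> a^# = a -> nrm a <= dist I a.
Proof.
move=> Ca sa; rewrite leNgt; apply/negP => da.
have a0 : 0 < nrm a := le_lt_trans (dist_ge0 I a) da.
pose u n := iter n (fun z => z ** z) ((nrm a)^-1%:C%C *: a).
have uP n : [/\ carrier C (u n), (u n)^# = u n, nrm (u n) = 1 &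
    dist I (u n) <= (dist I a / nrm a) ^+ (2 ^ n)].
  elim: n => [|n [Cu su u1 du]].
    split; first exact: carrierZ.
    - by rewrite /u /= cstarZr sa.
    - by rewrite /u /= nrmZ ger0_norm ?invr_ge0 ?nrm_ge0// mulVf// gt_eqF.
    - rewrite expr1; apply: (le_trans (distZ _ _ _)).
      by rewrite ger0_norm ?invr_ge0 ?nrm_ge0// mulrC.
  rewrite /u iterS -/(u n); split; first exact: carrierM.
  - by rewrite cstarM su.
  - by rewrite -{1}su nrm_star_mul u1 expr1n.
  - apply: le_trans (_ : dist I (u n) * dist I (u n) <= _).
      by apply: distM => z Iz; case: (CI Cu Iz).
    rewrite expnS mul2n -addnn exprD.
    by rewrite ler_pM ?dist_ge0.
set t := dist I a / nrm a in uP.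
have t01 : 0 <= t < 1.
  by rewrite divr_ge0 ?dist_ge0 ?nrm_ge0//= ltr_pdivrMr// mul1r.
have [n tn] : exists n, t ^+ (2 ^ n) <= 1 / 10.
  have /cvgrPdist_lt/(_ (1 / 10))[|n _ tn] : t ^+ n @[n --> \oo] --> 0.
  - by apply: cvg_expr; case/andP: t01 => t0 t1; rewrite ger0_norm.
  - lra.
  - exists n; have := tn _ (ltnW (ltn_expl n (isT : (1 < 2)%N))).
    rewrite /= sub0r normrN => /ltW.
    by apply: le_trans; exact: ler_norm.
have [Cu su u1 du] := uP n.
have := dist_selfadjoint_gt Cu su CI CI0 u1; lra.
Qed.

(** An injective morphism from a C*-algebra is isometric; here for the map from
    C to the quotient by I, whose seminorm need not be known to satisfy the
    C*-identity. The self-adjoint case applied to c^* c gives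
    |c|^2 <= dist (c^* c) <= (dist c)^2. *)
Theorem nrm_le_dist c : carrier C c -> nrm c <= dist I c.
Proof.
move=> Cc; have [c0|c0] := eqVneq (nrm c) 0; first by rewrite c0 dist_ge0.
have cgt0 : 0 < nrm c by rewrite lt_def c0 nrm_ge0.
have dstar : dist I c^# <= dist I c.
  apply/ler_addgt0Pr => e /(dist_approx I c)[y Iy cy].
  apply: le_trans (dist_le _ (carrier_star Iy)) _.
  by rewrite -cstarD nrm_star ltW.
have Cs := carrier_star Cc.
have := nrm_le_dist_sa (carrierM Cs Cc); rewrite cstarM cstarK => /(_ erefl).
rewrite nrm_star_mul => /le_trans.
have dM : dist I (c^# ** c) <= dist I c^# * dist I c.
  by apply: distM => z Iz; [case: (CI Cs Iz)|case: (CI Cc Iz)].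
move/(_ _ dM) => n2; have := dist_ge0 I c; nra.
Qed.

Lemma nrm_le_add c y : carrier C c -> carrier I y -> nrm c <= nrm (c + y).
Proof. by move=> Cc Iy; exact: le_trans (nrm_le_dist Cc) (dist_le _ Iy). Qed.

(** The C-components of a convergent sequence of sums form a Cauchy sequence by
    nrm_le_add. *)
Lemma closed_add :
  closed [set x | exists c y, [/\ carrier C c, carrier I y & x = c + y]].
Proof.
move=> x /closure_nrmP xD.
pose r n : R := 2 / n.+2%:R.
have r_gt0 n : 0 < r n by rewrite divr_gt0.
have r_mono n m : (n <= m)%N -> r m <= r n.
  by move=> nm; rewrite ler_pM2l// lef_pV2 ?posrE// ler_nat.
have /choice[cy cyP] n : exists cy : A * A,
    [/\ carrier C cy.1, carrier I cy.2 & nrm (x - (cy.1 + cy.2)) < r n].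
  by have [_ [c [y [Cc Iy ->]]] xcy] := xD _ (r_gt0 n); exists (c, y).
pose c n := (cy n).1; pose y n := (cy n).2.
have r_le K (e : R) : 0 < K -> 0 < e ->
    exists N, forall n, (N <= n)%N -> K * r n <= e.
  move=> K0 e0; have eK : 0 < e / K by rewrite divr_gt0.
  have [N HN] := rate_le eK; exists N => n /HN.
  by rewrite -/(r n) ler_pdivlMr// mulrC.
have c_cauchy n m : (n <= m)%N -> nrm (c m - c n) <= 2 * r n.
  move=> nm; have [Cn In xn] := cyP n; have [Cm Im xm] := cyP m.
  have CB : carrier C (c m - c n).
    by apply: carrierD => //; rewrite -scaleN1r; exact: carrierZ.
  have IB : carrier I (y m - y n).
    by apply: carrierD => //; rewrite -scaleN1r; exact: carrierZ.
  apply: (le_trans (nrm_le_add CB IB)).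
  have -> : c m - c n + (y m - y n) = (x - (c n + y n)) - (x - (c m + y m)).
    by rewrite opprB [RHS]addrC subrKA opprD addrACA.
  have := nrmB (x - (c n + y n)) (x - (c m + y m)).
  have := r_mono _ _ nm; rewrite /c /y; lra.
have Cc n : carrier C (c n) by case: (cyP n).
have [l Cl cl] := exists_limit (@carrier_closed _ _ C) Cc
  (fun e => @r_le 2 e (ltr0Sn R 1)) c_cauchy.
exists l, (x - l); split=> //; last by rewrite addrC subrK.
apply: closed_nrm; first exact: carrier_closed.
move=> e e0; have e2 : 0 < e / 2 by rewrite divr_gt0.
have [N /(_ _ (leqnn N)) HN] := r_le 3 _ (ltr0Sn R 2) e2.
have [_ IN xN] := cyP N; exists (y N) => //.
have -> : x - l - y N = (x - (c N + y N)) - (l - c N).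
  by rewrite opprB opprD [x + (_ + _)]addrA [RHS]addrAC subrKA.
have := nrmB (x - (c N + y N)) (l - c N); have := cl N; rewrite /c /y in xN *; lra.
Qed.

End isometry.

(** * Finite sums of components *)

Section graded_sums.
Variables (d : Order.disp_t) (L : meetSemilatticeType d) (R : realType).
Variables (A : cstarAlgType R) (A_ : L -> subCstarAlg A).
Implicit Types (F G : seq L) (i j m n : L) (a b x : A).

Definition sum_over F : set A :=
  [set a | exists2 S : L -> A, (forall j, carrier (A_ j) (S j)) &
           a = \sum_(j <- F) S j].

Lemma sum_over0 F : sum_over F 0.
Proof. by exists (fun=> 0) => [j|]; [exact: carrier0|rewrite big1]. Qed.

Lemma sum_overD F a b : sum_over F a -> sum_over F b -> sum_over F (a + b).
Proof.
move=> [S AS ->] [T AT ->]; exists (fun j => S j + T j); last by rewrite big_split.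
by move=> j; exact: carrierD.
Qed.

Lemma sum_overZ F (k : R[i]) a : sum_over F a -> sum_over F (k *: a).
Proof.
move=> [S AS ->]; exists (fun j => k *: S j); last by rewrite scaler_sumr.
by move=> j; exact: carrierZ.
Qed.

Lemma sum_over_star F a : sum_over F a -> sum_over F a^#.
Proof.
move=> [S AS ->]; exists (fun j => (S j)^#); first by move=> j; exact: carrier_star.
by rewrite (big_morph _ (@cstarD _ A) (@cstar0 _ A)).
Qed.

Lemma sum_over1 F j x : uniq F -> j \in F -> carrier (A_ j) x -> sum_over F x.
Proof.
move=> uF jF Ax; exists (fun l => if l == j then x else 0).
  by move=> l; case: eqP => [->//|_]; exact: carrier0.
rewrite (bigD1_seq j)//= eqxx big1 ?addr0// => l /negbTE ->//.
Qed.

Lemma sum_over_sub F G : uniq F -> {subset G <= F} -> sum_over G `<=` sum_over F.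
Proof.
move=> uF GF a [S AS ->]; rewrite big_seq; apply: big_ind.
- exact: sum_over0.
- by move=> b c; exact: sum_overD.
- by move=> j /GF jF; exact: sum_over1 (AS j).
Qed.

Lemma sum_over_rem F j a : j \in F -> sum_over F a ->
  exists2 x, carrier (A_ j) x & exists2 b, sum_over (rem j F) b & a = x + b.
Proof.
move=> jF [S AS ->]; exists (S j); first exact: AS.
by exists (\sum_(l <- rem j F) S l); [exists S|exact: big_rem].
Qed.

Hypothesis grA : graded A_.

Lemma sum_over_mul F G H a b : uniq H ->
  {in F & G, forall i j, (i `&` j)%O \in H} ->
  sum_over F a -> sum_over G b -> sum_over H (a ** b).
Proof.
move=> uH FGH [S AS ->] [T AT ->].
rewrite (big_morph (fun z => z ** _) (fun x y => cmulDl x y _) (cmul0l _)).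
rewrite big_seq; apply: big_ind; [exact: sum_over0|by move=> *; exact: sum_overD|].
move=> i iF; rewrite (big_morph (cmul (S i)) (cmulDr _) (cmul0r _)).
rewrite big_seq; apply: big_ind; [exact: sum_over0|by move=> *; exact: sum_overD|].
move=> j jG; apply: (@sum_over1 _ (i `&` j)%O) => //; first exact: FGH.
exact: (graded_mul grA).
Qed.

Lemma sum_over_free F (S : L -> A) : uniq F -> (forall j, carrier (A_ j) (S j)) ->
  \sum_(j <- F) S j = 0 -> {in F, forall j, S j = 0}.
Proof.
move=> uF AS S0 j jF.
pose T l := if l \in F then S l else 0.
have AT l : carrier (A_ l) (T l) by rewrite /T; case: ifP => // _; exact: carrier0.
have Tsub : [set l | T l != 0] `<=` [set` F].
  by move=> l /=; rewrite /T; case: ifP => //; rewrite eqxx.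
have finT : finite_set [set l | T l != 0].
  by apply: sub_finite_set Tsub _; exact: finite_seq.
suff /(graded_free grA AT finT)/(_ j) : \sum_(l \in [set: L]) T l = 0.
  by rewrite /T jF.
rewrite -(@fsbig_widen _ _ _ _ [set` F])//; last first.
  by move=> l [_ /= /negP/negbTE lF]; rewrite /T lF.
rewrite -fsbig_seq//; apply: etrans S0; rewrite big_seq [RHS]big_seq.
by apply: eq_bigr => l lF; rewrite /T lF.
Qed.

(** Linear independence of the components, in the form of a direct sum of one
    component and finitely many others. *)
Lemma sum_over_component F j x b : uniq F -> j \notin F ->
  carrier (A_ j) x -> sum_over F b -> x + b = 0 -> x = 0.
Proof.
move=> uF jF Ax [S AS ->] xS.
pose T l := if l == j then x else S l.
have AT l : carrier (A_ l) (T l) by rewrite /T; case: eqP => // ->.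
have ujF : uniq (j :: F) by rewrite /= jF.
have := @sum_over_free (j :: F) T ujF AT _ j (mem_head _ _).
rewrite /T eqxx; apply; rewrite big_cons eqxx; apply: etrans xS; congr (_ + _).
rewrite big_seq [RHS]big_seq; apply: eq_bigr => l lF.
by case: eqP lF => // ->; rewrite (negbTE jF).
Qed.

Definition meet_closed F := {in F &, forall i j, (i `&` j)%O \in F}.

Definition maximal_in F m := m \in F /\ {in F, forall j, (m <= j)%O -> j = m}.

Lemma exists_maximal F i : i \in F -> exists m, maximal_in F m.
Proof.
elim: F i => [//|j F IH] i _; case: F IH => [_|j' F IH].
  by exists j; split=> [|l]; rewrite ?mem_head// inE => /eqP.
have [m [mF mmax]] := IH j' (mem_head _ _).
have [mj|mj] := boolP (m <= j)%O; last first.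
  exists m; split=> [|l]; first by rewrite inE mF orbT.
  by rewrite inE => /orP[/eqP -> ml|]; [rewrite ml in mj|exact: mmax].
exists j; split=> [|l]; first exact: mem_head.
rewrite inE => /orP[/eqP //|lF jl].
have lm := mmax _ lF (le_trans mj jl).
by apply/eqP; rewrite eq_le jl lm mj.
Qed.

(** A maximal m is a meet i /\ j of members of F only if i = j = m, so the other
    indices form a subsemilattice stable under the meet with m. *)
Lemma meet_closed_rem F m : uniq F -> meet_closed F -> maximal_in F m ->
  meet_closed (rem m F) /\ {in rem m F, forall j, (j `&` m)%O \in rem m F}.
Proof.
move=> uF cF [mF mmax].
have key j l : j \in rem m F -> l \in F -> (j `&` l)%O \in rem m F.
  rewrite !mem_rem_uniq// !inE => /andP[jm jF] lF; rewrite cF// andbT.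
  by apply: contra jm => /eqP jl; rewrite [j]mmax// -jl leIl.
split=> [j l jF lF|j jF]; last exact: key.
by apply: key => //; exact: mem_rem lF.
Qed.

Lemma sum_overM F a b : uniq F -> meet_closed F ->
  sum_over F a -> sum_over F b -> sum_over F (a ** b).
Proof. by move=> uF cF; exact: sum_over_mul. Qed.

Definition sum_alg F (uF : uniq F) (cF : meet_closed F)
    (clF : closed (sum_over F)) : subCstarAlg A :=
  SubCstarAlg (@sum_over0 F) (@sum_overD F) (@sum_overZ F)
    (fun a b => @sum_overM F a b uF cF) (@sum_over_star F) clF.

Lemma sum_over_component_mul F j x b : uniq F ->
  {in F, forall i, (j `&` i)%O \in F} -> carrier (A_ j) x -> sum_over F b ->
  sum_over F (x ** b) /\ sum_over F (b ** x).
Proof.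
move=> uF jF Ax Fb.
have jx : sum_over [:: j] x by apply: sum_over1 Ax; rewrite ?mem_head.
split; [apply: sum_over_mul jx Fb|apply: sum_over_mul Fb jx] => //.
  by move=> i l; rewrite inE => /eqP -> lF; exact: jF.
by move=> l i lF; rewrite inE meetC => /eqP ->; exact: jF.
Qed.

(** Removing a maximal index m leaves an ideal of the sum, closed by induction
    and disjoint from the component at m, so closed_add applies. *)
Lemma sum_over_closed F : uniq F -> meet_closed F -> closed (sum_over F).
Proof.
have [n] := ubnP (size F); elim: n F => // n IH F sF uF cF.
have [F0|F0] := eqVneq F [::].
  rewrite F0 => x /closure_nrmP x0.
  suff -> : x = 0 by exact: sum_over0.
  apply: nrm_eq0; apply/eqP; rewrite eq_le nrm_ge0 andbT.
  apply/ler_addgt0Pr => e /x0[_ [S _ ->]].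
  by rewrite big_nil subr0 add0r => /ltW.
have [i iF] : exists i, i \in F.
  by case: F F0 {IH sF uF cF} => // i F _; exists i; exact: mem_head.
have [m mmax] := exists_maximal iF; have mF := mmax.1.
have [crF mrF] := meet_closed_rem uF cF mmax; have urF := rem_uniq m uF.
have sr : (size (rem m F) < n)%N.
  by rewrite size_rem// prednK ?(leq_trans _ sF)//; case: (F) mF.
pose I := sum_alg urF crF (IH _ sr urF crF).
have Im x y : carrier (A_ m) x -> carrier I y ->
    carrier I (x ** y) /\ carrier I (y ** x).
  move=> Ax Iy; apply: sum_over_component_mul Ax Iy => //.
  by move=> j /mrF; rewrite meetC.
have I0 x : carrier (A_ m) x -> carrier I x -> x = 0.
  move=> Ax Ix; apply: (@sum_over_component (rem m F) m x (- x)) => //.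
  - by rewrite mem_rem_uniqF.
  - by rewrite -scaleN1r; exact: sum_overZ.
  - by rewrite subrr.
suff -> : sum_over F = [set x | exists c y,
    [/\ carrier (A_ m) c, carrier I y & x = c + y]] by exact: closed_add.
apply/seteqP; split=> [a /(sum_over_rem mF)[x Ax [b Fb ->]]|_ [x [b [Ax Fb ->]]]].
  by exists x, b.
apply: sum_overD; first exact: sum_over1 Ax.
by apply: sum_over_sub Fb => // j; exact: mem_rem.
Qed.

(** * Injectivity on finite sums and on their closure *)

Lemma component_mul_eq0 j x : carrier (A_ j) x ->
  (forall b, carrier (A_ j) b -> x ** b = 0) -> x = 0.
Proof.
move=> Ax /(_ _ (carrier_star Ax)) xx.
have := nrm_star_mul x^#; rewrite cstarK xx nrm0 => /esym/eqP.
by rewrite sqrf_eq0 => /eqP/nrm_eq0 x0; rewrite -(cstarK x) x0 cstar0.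
Qed.

Definition annihilates i a := forall x, carrier (A_ i) x -> a ** x = 0 /\ x ** a = 0.

Lemma sum_over_stable i F b x : {in F, forall j, (i <= j)%O} ->
  sum_over F b -> carrier (A_ i) x ->
  carrier (A_ i) (b ** x) /\ carrier (A_ i) (x ** b).
Proof.
move=> Fi Fb Ax; have ix : sum_over [:: i] x by apply: sum_over1 Ax; rewrite ?mem_head.
have i1 y : sum_over [:: i] y -> carrier (A_ i) y.
  by move=> [S AS ->]; rewrite big_seq1; exact: AS.
split; apply: i1; [apply: sum_over_mul Fb ix|apply: sum_over_mul ix Fb] => //.
  by move=> j l /Fi ij; rewrite inE => /eqP ->; rewrite meet_r// mem_head.
by move=> l j; rewrite inE => /eqP -> /Fi ij; rewrite meet_l// mem_head.
Qed.

Lemma annihilates_mul i F a b : {in F, forall j, (i <= j)%O} ->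
  annihilates i a -> sum_over F b ->
  annihilates i (a ** b) /\ annihilates i (b ** a).
Proof.
move=> Fi ann Fb; split=> x Ax; have [bx xb] := sum_over_stable Fi Fb Ax.
  by rewrite -cmulA (ann _ bx).1 cmulA (ann _ Ax).2 cmul0l.
by rewrite -cmulA (ann _ Ax).1 cmul0r cmulA (ann _ xb).2.
Qed.

(** The common two-sided annihilator of a component is a C*-algebra, normalized
    by the components above; it plays the role of the kernel. *)
Section annihilator.
Variable i : L.

Let ann0 : annihilates i 0.
Proof. by move=> x _; rewrite cmul0l cmul0r. Qed.

Let annD a b : annihilates i a -> annihilates i b -> annihilates i (a + b).
Proof.
move=> annA annB x Ax; rewrite cmulDl cmulDr.
by rewrite (annA _ Ax).1 (annA _ Ax).2 (annB _ Ax).1 (annB _ Ax).2 addr0.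
Qed.

Let annZ (k : R[i]) a : annihilates i a -> annihilates i (k *: a).
Proof.
by move=> ann x Ax; rewrite cmulZl cmulZr (ann _ Ax).1 (ann _ Ax).2 scaler0.
Qed.

Let annM a b : annihilates i a -> annihilates i b -> annihilates i (a ** b).
Proof.
move=> annA annB x Ax; split.
  by rewrite -cmulA (annB _ Ax).1 cmul0r.
by rewrite cmulA (annA _ Ax).2 cmul0l.
Qed.

Let ann_star a : annihilates i a -> annihilates i a^#.
Proof.
move=> ann x Ax; have [ax xa] := ann _ (carrier_star Ax).
by rewrite -(cstarK x) -!cstarM ax xa cstar0.
Qed.

Let ann_closed : closed (annihilates i).
Proof.
move=> a /closure_nrmP ann x Ax.
have small z : (forall e : R, 0 < e -> nrm z <= e * nrm x) -> z = 0.
  move=> ze; apply: nrm_eq0; apply/eqP; rewrite eq_le nrm_ge0 andbT.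
  apply/ler_addgt0Pr => e e0; rewrite add0r.
  have x1 : 0 < nrm x + 1 by rewrite ltr_wpDl ?nrm_ge0.
  apply: (le_trans (ze _ (divr_gt0 e0 x1))).
  by rewrite mulrAC ler_pdivrMr// ler_pM2l// lerDl.
split; apply: small => e /ann[b annb ab].
  have -> : a ** x = (a - b) ** x by rewrite cmulBl (annb _ Ax).1 subr0.
  by apply: (le_trans (nrmM _ _)); rewrite ler_wpM2r ?nrm_ge0// ltW.
have -> : x ** a = x ** (a - b) by rewrite cmulBr (annb _ Ax).2 subr0.
by apply: (le_trans (nrmM _ _)); rewrite mulrC ler_wpM2r ?nrm_ge0// ltW.
Qed.

Definition annihilator : subCstarAlg A :=
  SubCstarAlg ann0 annD annZ annM ann_star ann_closed.

End annihilator.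

(** Triviality of the inverse image of A_m under the structure morphism from
    A_l, with multipliers replaced by their action. *)
Hypothesis structure_inj : forall m l y z, (m < l)%O ->
  carrier (A_ l) y -> carrier (A_ m) z ->
  (forall x, carrier (A_ m) x -> y ** x = z ** x /\ x ** y = x ** z) -> y = 0.

(** Induction on the size of F. Multiplying a by an element of the component at
    n moves it to the indices below n, where the induction applies whenever
    some index of F is not below n. This gives a b = b a = 0 for b in A_n, hence
    equations for the coefficient at n. For a maximal m which is not the
    largest element, n = m shows that the coefficient x at m vanishes. If m is
    the largest element, let n be maximal among the others, with coefficient
    y: then (x + y) b = b (x + y) = 0, so x acts on A_n as the element - y of
    A_n, and x = 0 by hypothesis. *)
Lemma sum_over_annihilates F i a : uniq F -> meet_closed F -> i \in F ->
  {in F, forall j, (i <= j)%O} -> sum_over F a -> annihilates i a -> a = 0.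
Proof.
have [s] := ubnP (size F); elim: s F a => // s IH F a sF uF cF iF Fi Fa ann.
have below n m : n \in F -> m \in F -> ~~ (m <= n)%O ->
    forall b, carrier (A_ n) b -> a ** b = 0 /\ b ** a = 0.
  move=> nF mF mn b Ab; pose G := [seq j <- F | (j <= n)%O].
  have sG : (size G < s)%N.
    rewrite -ltnS (leq_trans _ sF)// ltnS size_filter.
    rewrite -(count_predC (fun j => (j <= n)%O) F) -addn1 leq_add2l -has_count.
    by apply/hasP; exists m.
  have uG : uniq G by exact: filter_uniq.
  have cG : meet_closed G.
    move=> j l; rewrite !mem_filter => /andP[jn jF] /andP[_ lF].
    by rewrite cF// andbT (le_trans (leIl _ _)).
  have iG : i \in G by rewrite mem_filter Fi.
  have Gi : {in G, forall j, (i <= j)%O}.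
    by move=> j; rewrite mem_filter => /andP[_ /Fi].
  have nb : sum_over [:: n] b by apply: sum_over1 Ab; rewrite ?mem_head.
  have ni : {in [:: n], forall j, (i <= j)%O}.
    by move=> j; rewrite inE => /eqP ->; exact: Fi.
  have [annab annba] := annihilates_mul ni ann nb.
  split; apply: (IH G) => //.
    apply: sum_over_mul Fa nb => // j l jF; rewrite inE => /eqP ->.
    by rewrite mem_filter leIr cF.
  apply: sum_over_mul nb Fa => // l j; rewrite inE => /eqP -> jF.
  by rewrite mem_filter leIl cF.
have [m mmax] := exists_maximal iF; have mF := mmax.1.
have [crF mrF] := meet_closed_rem uF cF mmax; have urF := rem_uniq m uF.
have [x Ax [a' Fa' aE]] := sum_over_rem mF Fa.
(* When the minimum i is also maximal, F is reduced to i. *)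
have [im|im] := eqVneq i m.
  have a'0 : a' = 0.
    case: Fa' => S _ ->; rewrite big_seq big_pred0// => j.
    apply/negbTE; rewrite mem_rem_uniq// inE; apply/negP => /andP[/eqP jm jF].
    by apply: jm; apply: mmax.2 => //; rewrite -im Fi.
  rewrite aE a'0 addr0 in ann *; apply: (component_mul_eq0 Ax) => b Ab.
  by apply: (ann b _).1; rewrite im.
suff x0 : x = 0.
  rewrite aE x0 add0r in ann *; apply: (IH (rem m F)) => //.
  - by rewrite size_rem// prednK ?(leq_trans _ sF)//; case: (F) mF.
  - by rewrite mem_rem_uniq// inE im.
  - by move=> j /mem_rem/Fi.
have [top|/allPn[j jF jm]] := boolP (all (fun j => j <= m)%O F); last first.
  apply: (component_mul_eq0 Ax) => b Ab; have [ab0 _] := below m j mF jF jm b Ab.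
  apply: (@sum_over_component (rem m F) m _ (a' ** b)) => //.
  - by rewrite mem_rem_uniqF.
  - exact: carrierM.
  - have [] := sum_over_component_mul urF _ Ab Fa' => // l /mrF; by rewrite meetC.
  - by rewrite -cmulDl -aE.
have irF : i \in rem m F by rewrite mem_rem_uniq// inE im.
have [n nmax] := exists_maximal irF.
have nF : n \in F by apply: mem_rem nmax.1.
have nm : (n < m)%O.
  rewrite lt_neqAle (allP top _ nF) andbT.
  by have := nmax.1; rewrite mem_rem_uniq// inE => /andP[].
have [crF' nrF'] := meet_closed_rem urF crF nmax; have urF' := rem_uniq n urF.
have [y Ay [a'' Fa'' a'E]] := sum_over_rem nmax.1 Fa'.
have Ay' : carrier (A_ n) (- y) by rewrite -scaleN1r; exact: carrierZ.
apply: (structure_inj nm Ax Ay') => b Ab.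
have mn : ~~ (m <= n)%O by rewrite lt_geF.
have [ab0 ba0] := below n m nF mF mn b Ab.
have [Axb Abx] : carrier (A_ n) (x ** b) /\ carrier (A_ n) (b ** x).
  have := (graded_mul grA) _ _ _ _ Ax Ab; have := (graded_mul grA) _ _ _ _ Ab Ax.
  by rewrite meet_l ?meet_r ?(ltW nm).
have nrF'' : {in rem n (rem m F), forall l, (n `&` l)%O \in rem n (rem m F)}.
  by move=> l /nrF'; rewrite meetC.
have [bF' Fb'] := sum_over_component_mul urF' nrF'' Ab Fa''.
have nF' : n \notin rem n (rem m F) by rewrite mem_rem_uniqF.
have [Ayb Aby] := (carrierM Ay Ab, carrierM Ab Ay).
split; apply/eqP; rewrite -subr_eq0 -?cmulBl -?cmulBr opprK; apply/eqP.
  apply: (sum_over_component urF' nF' _ Fb').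
    by rewrite cmulDl; exact: carrierD.
  by rewrite -cmulDl -addrA -a'E -aE.
apply: (sum_over_component urF' nF' _ bF').
  by rewrite cmulDr; exact: carrierD.
by rewrite -cmulDr -addrA -a'E -aE.
Qed.

Lemma component_sum_over i a : component_sum A_ (up i) a ->
  exists F, [/\ uniq F, {in F, forall j, (i <= j)%O} & sum_over F a].
Proof.
move=> [S [AS finS ->]].
exists (finite_support 0 (up i) S); split; [exact: finite_support_uniq| |by exists S].
by case: finite_supportP => // X Xup _ _ j /Xup.
Qed.

(** Adjoining x to a subsemilattice G amounts to adjoining x and the meets of x
    with G. *)
Lemma exists_meet_closed i F : {in F, forall j, (i <= j)%O} -> exists G,
  [/\ uniq G, meet_closed G, i \in G, {in G, forall j, (i <= j)%O} &
      {subset F <= G}].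
Proof.
elim: F => [|x F IH] Fi.
  exists [:: i]; split=> //; last by move=> j; rewrite inE => /eqP ->.
    by move=> j l; rewrite !inE => /eqP -> /eqP ->; rewrite meetxx.
  by rewrite mem_head.
have [|G [uG cG iG Gi FG]] := IH; first by move=> j jF; apply: Fi; rewrite inE jF orbT.
have ix : (i <= x)%O by apply: Fi; rewrite mem_head.
pose H := undup (x :: G ++ [seq (x `&` y)%O | y <- G]).
have inH z : reflect
    [\/ z = x, z \in G | exists2 y, y \in G & z = (x `&` y)%O] (z \in H).
  rewrite mem_undup inE mem_cat; apply: (iffP or3P) => -[].
  - by move=> /eqP; constructor 1.
  - by constructor 2.
  - by move=> /mapP; constructor 3.
  - by move=> /eqP; constructor 1.
  - by constructor 2.
  - by move=> yP; constructor 3; apply/mapP.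
exists H; split.
- exact: undup_uniq.
- move=> z w /inH zP /inH wP; apply/inH.
  case: zP wP => [->|zG|[y yG ->]] [->|wG|[u uG' ->]].
  + by constructor 1; rewrite meetxx.
  + by constructor 3; exists w.
  + by constructor 3; exists u => //; rewrite meetA meetxx.
  + by constructor 3; exists z => //; rewrite meetC.
  + by constructor 2; exact: cG.
  + by constructor 3; exists (z `&` u)%O; [exact: cG|rewrite meetCA].
  + by constructor 3; exists y => //; rewrite meetC meetA meetxx.
  + by constructor 3; exists (y `&` w)%O; [exact: cG|rewrite meetA].
  + by constructor 3; exists (y `&` u)%O; [exact: cG|rewrite meetACA meetxx].
- by apply/inH; constructor 2.
- move=> z /inH[->//|/Gi//|[y /Gi iy ->]]; by rewrite lexI ix.
- move=> z; rewrite inE => /orP[/eqP ->|/FG zG]; apply/inH; first by constructor 1.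
  by constructor 2.
Qed.

(** An element b of a finite subsemilattice sum is at least as far from the
    annihilator as from 0, by nrm_le_add; if b is close to a, which annihilates,
    then b is small, and so is a. *)
Lemma approximable_annihilates i a :
  (forall e : R, 0 < e -> exists F b,
    [/\ uniq F, {in F, forall j, (i <= j)%O}, sum_over F b & nrm (a - b) < e]) ->
  annihilates i a -> a = 0.
Proof.
move=> acl ann; apply: nrm_eq0; apply/eqP.
rewrite eq_le nrm_ge0 andbT; apply/ler_addgt0Pr => e e0; rewrite add0r.
have /acl[F [b [uF Fi Fb ab]]] : 0 < e / 2 by rewrite divr_gt0.
have [G [uG cG iG Gi FG]] := exists_meet_closed Fi.
pose C := sum_alg uG cG (sum_over_closed uG cG).
have Cb : carrier C b by exact: sum_over_sub Fb.
have CI x y : carrier C x -> carrier (annihilator i) y ->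
    carrier (annihilator i) (x ** y) /\ carrier (annihilator i) (y ** x).
  by move=> Cx Iy; have [] := annihilates_mul Gi Iy Cx.
have CI0 x : carrier C x -> carrier (annihilator i) x -> x = 0.
  exact: sum_over_annihilates.
have Ia : carrier (annihilator i) (- a).
  by rewrite -scaleN1r; exact: carrierZ.
have := nrm_le_add CI CI0 Cb Ia; rewrite nrmBC => ba.
rewrite -(subrK b a); apply: (le_trans (nrmD _ _)).
lra.
Qed.

End graded_sums.

Theorem proposition2p5p3 (d : Order.disp_t) (L : meetSemilatticeType d)
    (R : realType) (A : cstarAlgType R) (A_ : L -> subCstarAlg A)
    (grA : graded A_) :
  (forall (k l : L) (kl : (k < l)%O),
     structure_morphism grA (ltW kl) @^-1` range (@mult_embed R (A_ k))
       = [set 0]) ->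
  forall i : L, injective (@phi d L R A A_ grA i).
Proof.
move=> structure_ker i u v phi_uv.
have structure_inj m l y z : (m < l)%O ->
    carrier (A_ l) y -> carrier (A_ m) z ->
    (forall x, carrier (A_ m) x -> y ** x = z ** x /\ x ** y = x ** z) -> y = 0.
  move=> ml Ay Az yz.
  suff : [set 0] (insubC Ay) by move=> /(congr1 val).
  rewrite -(structure_ker _ _ ml); exists (insubC Az) => //.
  by apply: multiplier_eq => x; apply: val_inj; have [yx xy] := yz _ (carrierP x).
apply: val_inj; apply/eqP; rewrite -subr_eq0; apply/eqP.
apply: (approximable_annihilates grA structure_inj (i := i)).
  have clu := set_mem (valP u); have clv := set_mem (valP v).
  move=> e e0; have e2 : 0 < e / 2 by rewrite divr_gt0.
  have [b /component_sum_over[F [uF Fi Fb]] ub] := (closure_nrmP _ _).1 clu _ e2.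
  have [c /component_sum_over[G [uG Gi Gc]] vc] := (closure_nrmP _ _).1 clv _ e2.
  exists (undup (F ++ G)), (b - c); split.
  - exact: undup_uniq.
  - by move=> j; rewrite mem_undup mem_cat => /orP[/Fi|/Gi].
  - apply: sum_overD; last rewrite -scaleN1r; last apply: sum_overZ.
      apply: sum_over_sub Fb; rewrite ?undup_uniq// => j jF.
      by rewrite mem_undup mem_cat jF.
    apply: sum_over_sub Gc; rewrite ?undup_uniq// => j jG.
    by rewrite mem_undup mem_cat jG orbT.
  have -> : val u - val v - (b - c) = val u - b - (val v - c).
    by rewrite !opprB addrACA [RHS]addrACA; congr (_ + _); exact: addrC.
  by apply: (le_lt_trans (nrmB _ _)); lra.
move=> x Ax; rewrite cmulBl cmulBr; split; apply/eqP; rewrite subr_eq0; apply/eqP.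
  exact: (congr1 (fun f => val (lmult f (insubC Ax))) phi_uv).
exact: (congr1 (fun f => val (rmult f (insubC Ax))) phi_uv).
Qed.
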